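(* Let $1<p,q<\infty$ satisfy $1/p+1/q\geq 1$. Let $X$ and $Y$ be Banach spaces with unconditional finite-dimensional Schauder decompositions $\{X_i\}_{i\in I}$ and $\{Y_j\}_{j\in J}$, respectively (the index sets $I$, $J$ being arbitrary), such that $\{X_i\}_{i\in I}$ has a disjoint lower $p$-estimate and $\{Y_j\}_{j\in J}$ has a disjoint lower $q$-estimate. If $X$ and $Y$ have the Schur property, then so does the projective tensor product $X\widehat{\otimes}_\pi Y$.
   Context: By a subspace of a Banach space we mean a norm closed linear subspace. A Banach space has the Schur property if every weakly convergent sequence in it is norm convergent. An unconditional Schauder decomposition of a Banach space $X$ is a family $\{X_i\}_{i\in I}$ of subspaces of $X$ such that each $x\in X$ can be written in a unique way as $x=\sum_{i\in I} x_i$ with $x_i\in X_i$ for all $i\in I$ and the series unconditionally convergent. For each $i \in I$ there is the associated bounded projection $P_i$ from $X$ onto $X_i$, so that $x=\sum_{i\in I}P_i(x)$ for all $x \in X$; for $C\subseteq I$, $P_C(x):=\sum_{i\in C}P_i(x)$ defines a bounded projection. The decomposition is finite-dimensional if each $X_i$ is finite-dimensional. For $1<p<\infty$, an unconditional Schauder decomposition $\{X_i\}_{i\in I}$ of $X$ has a disjoint lower $p$-estimate if there is a constant $c>0$ such that, for every finite collection $C_1,\dots,C_r$ of pairwise disjoint finite subsets of $I$ and every $x\in X$, $\left(\sum_{k=1}^r \|P_{C_k}(x)\|^p\right)^{1/p} \leq c \|x\|$. $\widehat{\otimes}_\pi$ denotes the projective tensor product of Banach spaces. *)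

(* Defs.v *)
From HB Require Import structures.
From mathcomp Require Import all_boot all_order all_algebra.
From mathcomp Require Import finmap complex.
From mathcomp Require Import all_classical all_reals all_analysis.
From mathcomp Require Import summability.

Set Implicit Arguments.
Unset Strict Implicit.
Unset Printing Implicit Defensive.

Import Order.TTheory GRing.Theory Num.Theory.
Import numFieldNormedType.Exports.

Local Open Scope classical_set_scope.
Local Open Scope ring_scope.

(* Banach spaces are over the real or the complex numbers. *)
Variant scalar_kind := RealScalars | ComplexScalars.

Definition scalars (R : realType) (s : scalar_kind) : numFieldType :=
  match s with RealScalars => R | ComplexScalars => R[i] end.

Definition scalar_re (R : realType) (s : scalar_kind) : scalars R s -> R :=
  match s return scalars R s -> R with
  | RealScalars => fun z => z
  | ComplexScalars => fun z => complex.Re z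
  end.

(* The library norm of a vector lies in the scalar field, although it is always
   a nonnegative real there; [rnorm] is the same number as an element of [R]. *)
Definition rnorm (R : realType) (s : scalar_kind)
    (X : normedModType (scalars R s)) (x : X) : R :=
  scalar_re `|x|.

Definition weakly_cvg (K : numFieldType) (X : normedModType K)
    (u : nat -> X) (x : X) : Prop :=
  forall f : {linear X -> K^o}, continuous f -> (f \o u) @ \oo --> f x.

Definition schur (K : numFieldType) (X : normedModType K) : Prop :=
  forall (u : nat -> X) (x : X), weakly_cvg u x -> cvg (u @ \oo).

Definition subspace_of (K : numFieldType) (X : normedModType K)
    (A : set X) : Prop :=
  [/\ closed A, A 0 & forall (a : K) u v, A u -> A v -> A (a *: u + v)].

Definition finite_dimensional (K : numFieldType) (X : normedModType K)
    (A : set X) : Prop :=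
  exists (n : nat) (e : 'I_n -> X),
    A = [set \sum_(k < n) a k *: e k | a in [set: 'I_n -> K]].

(* [a] expands [x] along [Xs]; unconditional convergence of a family is
   convergence of the net of its sums over the finite subsets of [I]. *)
Definition expansion (K : numFieldType) (X : normedModType K) (I : choiceType)
    (Xs : I -> set X) (x : X) (a : I -> X) : Prop :=
  (forall i, Xs i (a i)) /\ partial_sum a @ totally --> x.

Definition unconditional_decomposition (K : numFieldType)
    (X : normedModType K) (I : choiceType) (Xs : I -> set X) : Prop :=
  (forall i, subspace_of (Xs i)) /\
  forall x, exists! a : I -> X, expansion Xs x a.

(* The default value 0 is never used when [Xs] is a decomposition. *)
Definition decomposition_proj (K : numFieldType) (X : normedModType K)
    (I : choiceType) (Xs : I -> set X) (i : I) (x : X) : X :=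
  xget (fun=> 0) [set a | expansion Xs x a] i.

Definition disjoint_lower_estimate (R : realType) (s : scalar_kind)
    (X : normedModType (scalars R s)) (I : choiceType) (Xs : I -> set X)
    (p : R) : Prop :=
  exists2 c : R, 0 < c &
    forall (r : nat) (C : 'I_r -> {fset I}),
      (forall k l, k != l -> [disjoint C k & C l]%fset) ->
      forall x : X,
        (\sum_(k < r)
            rnorm (\sum_(i <- C k) decomposition_proj Xs i x) `^ p) `^ p^-1
        <= c * rnorm x.

(* A finite sequence of pairs (x_k, y_k) denotes the element sum_k x_k (x) y_k
   of the algebraic tensor product.  Two sequences denote the same tensor iff
   no bilinear form separates them. *)
Definition same_tensor (K : numFieldType) (X Y : normedModType K)
    (t t' : seq (X * Y)) : Prop :=
  forall f : {bilinear X -> Y -> K^o},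
    \sum_(z <- t) f z.1 z.2 = \sum_(z <- t') f z.1 z.2.

Definition projective_norm (R : realType) (s : scalar_kind)
    (X Y : normedModType (scalars R s)) (t : seq (X * Y)) : R :=
  inf [set \sum_(z <- t') rnorm z.1 * rnorm z.2 | t' in same_tensor t].

(* [T], with the canonical bilinear map [tens], is a completion of the algebraic
   tensor product of [X] and [Y] for the projective norm: the linear map induced
   by [tens] on the algebraic tensor product is isometric with dense range. *)
Definition projective_tensor_product (R : realType) (s : scalar_kind)
    (X Y : normedModType (scalars R s))
    (T : completeNormedModType (scalars R s))
    (tens : {bilinear X -> Y -> T}) : Prop :=
  (forall t : seq (X * Y),
     rnorm (\sum_(z <- t) tens z.1 z.2) = projective_norm t) /\
  dense [set \sum_(z <- t) tens z.1 z.2 | t in [set: seq (X * Y)]].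

(* Main.v *)
Require Import Defs.
From HB Require Import structures.
From mathcomp Require Import all_boot all_order all_algebra.
From mathcomp Require Import finmap complex.
From mathcomp Require Import all_classical all_reals all_analysis.
From mathcomp Require Import summability.
From mathcomp Require Import ring lra.

Import Order.TTheory GRing.Theory Num.Theory.
Import numFieldNormedType.Exports.
Local Open Scope ring_scope.

(** Let [u] be a weakly null sequence in the tensor product [T] with
[delta <= rnorm (u n)] for infinitely many [n]; the proof produces a bounded
functional that does not tend to zero along [u].

Let [P F] and [Q G] be the projections of the two decompositions onto the
coordinates in finite sets [F] and [G].  The lower estimate, applied to a single
set, bounds them uniformly, so the operators [P F (x) Q G] of [T] are uniformly
bounded and converge pointwise to the identity ([tens_approx]).  Moreover
[P F (x) id] has the form [u |-> sum_k e_k (x) (f_k (x) id) u], where the sum is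
finite and each [f_k (x) id] maps [T] to [Y]; as [Y] has the Schur property,
[P F (x) id] maps [u] to a norm null sequence, and likewise for [id (x) Q G]
([finite_rank_weakly_null]).  This is where finite-dimensionality of the summands
and the Schur property of the factors enter.

Consequently [u] can be followed by a gliding hump: there are indices [n k],
pairwise disjoint finite sets [F k] and pairwise disjoint finite sets [G k] such
that [u (n k)] is close to its diagonal block [B k (u (n k))], where
[B k := P (F k) (x) Q (G k)].  Choose functionals [phi k] of norm at most one
that norm [u (n k)], and consider [sum_k phi k \o B k].  On an elementary tensor
[x (x) y], the sum of the absolute values of its terms is at most
[sum_k |P (F k) x| |Q (G k) y|], which by Hoelder's inequality, the two lower
estimates and [1 <= p^-1 + q^-1] is at most a constant times [|x| |y|]
([block_functionals_bound]).  Hence the series defines a bounded functional on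
[T].  Its value at [u (n k)] stays away from zero: the block of [u (n k)] is
seen by the [k]-th term only, because [B j \o B k = 0] for [j != k], and the rest
of [u (n k)] is small.

Maps out of [T] are obtained by extending bounded bilinear maps
([tens_lift]); that their values depend only on the tensor, and the bound by the
projective norm, both follow by composing with norming functionals, that is, from
the Hahn-Banach theorem ([norming_functional]). *)

Set Implicit Arguments.
Unset Strict Implicit.
Unset Printing Implicit Defensive.

Local Open Scope classical_set_scope.
#[local] Existing Instance totally_filter.

(** * Real parts and the real-valued norm *)

Section Scalars.
Variables (R : realType) (s : scalar_kind).
Notation K := (scalars R s).

(** The inclusion of the reals into the scalars: with it, a real-linear map is
an additive map that commutes with [of_re s a *: _] for all real [a], whichever
the scalars are. *)
Definition of_re : R -> K :=
  match s return R -> scalars R s with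
  | RealScalars => id
  | ComplexScalars => fun r => r%:C%C
  end.

Lemma of_reD a b : of_re (a + b) = of_re a + of_re b.
Proof. by rewrite /of_re; case: s => //=; exact: rmorphD. Qed.

Lemma of_reM a b : of_re (a * b) = of_re a * of_re b.
Proof. by rewrite /of_re; case: s => //=; exact: rmorphM. Qed.

Lemma of_re1 : of_re 1 = 1.
Proof. by rewrite /of_re; case: s. Qed.

Lemma of_re0 : of_re 0 = 0.
Proof. by rewrite /of_re; case: s. Qed.

Lemma of_reN a : of_re (- a) = - of_re a.
Proof. by rewrite /of_re; case: s => //=; exact: rmorphN. Qed.

Lemma of_re_lt a b : (of_re a < of_re b) = (a < b).
Proof. by rewrite /of_re; case: s => //=; exact: ltcR. Qed.

Lemma of_re_le a b : (of_re a <= of_re b) = (a <= b).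
Proof. by rewrite /of_re; case: s => //=; exact: lecR. Qed.

Lemma of_reK : cancel of_re (@scalar_re R s).
Proof. by rewrite /of_re /scalar_re; case: s. Qed.

Lemma scalar_reK (z : K) : 0 <= z -> of_re (scalar_re z) = z.
Proof.
rewrite /of_re /scalar_re; case: s z => //= z.
by move=> z0; apply: RRe_real; rewrite realE z0.
Qed.

Lemma scalar_reD (a b : K) : scalar_re (a + b) = scalar_re a + scalar_re b.
Proof. by rewrite /scalar_re; case: s a b => //= -[? ?] [? ?]. Qed.

Lemma scalar_re0 : scalar_re (0 : K) = 0.
Proof. by rewrite -of_re0 of_reK. Qed.

Lemma scalar_reZ (a : R) (z : K) :
  scalar_re (of_re a * z) = a * scalar_re z.
Proof.
rewrite /of_re /scalar_re; case: s z => //= -[b c] /=.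
by rewrite mul0r subr0.
Qed.

Lemma scalar_re_sum (n : nat) (z : 'I_n -> K) :
  scalar_re (\sum_(k < n) z k) = \sum_(k < n) scalar_re (z k).
Proof.
apply: (big_morph (@scalar_re R s)); first exact: scalar_reD.
exact: scalar_re0.
Qed.

Lemma scalar_re_le (a b : K) : a <= b -> scalar_re a <= scalar_re b.
Proof.
by rewrite /scalar_re; case: s a b => //= a b; rewrite lecE => /andP[].
Qed.

Lemma scalar_re_norm_ge0 (z : K) : 0 <= scalar_re `|z|.
Proof. by rewrite -scalar_re0 scalar_re_le. Qed.

Lemma of_re_norm a : `|of_re a| = of_re `|a|.
Proof.
rewrite /of_re; case: s => //=.
by rewrite normc_def/= expr0n addr0 sqrtr_sqr.
Qed.

Lemma ler_scalar_re (z : K) : `|scalar_re z| <= scalar_re `|z|.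
Proof.
rewrite /scalar_re; case: s z => //= z.
by have := normc_ge_Re z; rewrite lecE => /andP[_].
Qed.

End Scalars.

Section RealNorm.
Variables (R : realType) (s : scalar_kind).
Notation K := (scalars R s).
Variable V : normedModType K.
Implicit Types x y : V.

Lemma rnormE x : of_re s (rnorm x) = `|x|.
Proof. exact: scalar_reK. Qed.

Lemma rnorm_ge0 x : 0 <= rnorm x.
Proof. by rewrite -(of_re_le s) of_re0 rnormE. Qed.

Lemma rnorm0 : rnorm (0 : V) = 0.
Proof. by rewrite /rnorm normr0 -(of_re0 R s) of_reK. Qed.

Lemma rnorm_eq0 x : rnorm x = 0 -> x = 0.
Proof. by move=> x0; apply: normr0_eq0; rewrite -rnormE x0 of_re0. Qed.

Lemma rnormD x y : rnorm (x + y) <= rnorm x + rnorm y.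
Proof. by rewrite /rnorm -scalar_reD; apply/scalar_re_le/ler_normD. Qed.

Lemma rnormN x : rnorm (- x) = rnorm x.
Proof. by rewrite /rnorm normrN. Qed.

Lemma rnormB x y : rnorm (x - y) = rnorm (y - x).
Proof. by rewrite /rnorm distrC. Qed.

Lemma rnorm_triangle x y z : rnorm (x - z) <= rnorm (x - y) + rnorm (y - z).
Proof. by rewrite -(subrKA y); exact: rnormD. Qed.

Lemma rnormZ (a : K) x : rnorm (a *: x) = scalar_re `|a| * rnorm x.
Proof.
by rewrite {1}/rnorm normrZ -rnormE -{1}(scalar_reK (normr_ge0 a)) -of_reM of_reK.
Qed.

Lemma rnormZ_re (a : R) x : rnorm (of_re s a *: x) = `|a| * rnorm x.
Proof. by rewrite rnormZ of_re_norm of_reK. Qed.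

Lemma rnorm_sum (I : Type) (r : seq I) (F : I -> V) :
  rnorm (\sum_(i <- r) F i) <= \sum_(i <- r) rnorm (F i).
Proof.
elim/big_ind2 : _ => [|x a y b xa yb|//]; first by rewrite rnorm0.
by apply: le_trans (rnormD _ _) _; exact: lerD.
Qed.

Lemma cvg_rnormP (U : Type) (F : set_system U) (FF : Filter F) (f : U -> V) x :
  f @ F --> x <-> forall e : R, 0 < e -> \forall t \near F, rnorm (x - f t) < e.
Proof.
split=> [/cvgrPdist_lt fx e e0|fx].
  have e0' : 0 < of_re s e by rewrite -(of_re0 R s) of_re_lt.
  by apply: filterS (fx _ e0') => t; rewrite -rnormE of_re_lt.
apply/cvgrPdist_lt => e e0; have e0' := ltW e0.
have {}/fx : 0 < scalar_re e by rewrite -(of_re_lt s) of_re0 scalar_reK.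
by apply: filterS => t; rewrite -(of_re_lt s) rnormE scalar_reK.
Qed.

Lemma cvg_seq_rnormP (u : nat -> V) x :
  u @ \oo --> x <->
  forall e : R, 0 < e -> exists N, forall n, (N <= n)%N -> rnorm (x - u n) < e.
Proof.
split=> [/cvg_rnormP H e /H [N _ HN]|H]; first by exists N.
by apply/cvg_rnormP => e /H[N HN]; exists N.
Qed.

End RealNorm.
Arguments cvg_rnormP {R s V U F FF f x}.

Lemma cauchy_seq_cvg (R : realType) (s : scalar_kind)
    (V : completeNormedModType (scalars R s)) (u : nat -> V) :
  (forall e : R, 0 < e -> exists N, forall n m, (N <= n)%N -> (N <= m)%N ->
    rnorm (u n - u m) <= e) -> cvg (u @ \oo).
Proof.
move=> H; apply/cauchy_cvgP/cauchy_ballP => e e0.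
have e20 : 0 < scalar_re e / 2.
  by rewrite divr_gt0// -(of_re_lt s) of_re0 scalar_reK// ltW.
have [N HN] := H _ e20.
exists ([set u n | n in [set n | (N <= n)%N]],
        [set u n | n in [set n | (N <= n)%N]]).
  by split; exists N => // n Nn; exists n.
move=> [_ _] [[n Nn <-] [m Nm <-]] /=; rewrite -ball_normE /=.
rewrite -rnormE -(scalar_reK (ltW e0)) of_re_lt.
by apply: le_lt_trans (HN _ _ Nn Nm) _; lra.
Qed.

(** * The Hahn-Banach theorem *)

Section BoundedLinear.
Variables (R : realType) (s : scalar_kind).
Notation K := (scalars R s).

Lemma rnorm_bounded_continuous (V W : normedModType K) (f : {linear V -> W})
    (C : R) :
  (forall x, rnorm (f x) <= C * rnorm x) -> continuous f.
Proof.
move=> fC x; apply/(@cvg_rnormP _ _ _ _ _ _ f) => e e0.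
have C0 : 0 < `|C| + 1 by rewrite ltr_wpDl.
have : \forall t \near x, rnorm (x - t) < e / (`|C| + 1).
  by apply: (@cvg_rnormP _ _ V V (nbhs x) _ id x).1 => //; rewrite divr_gt0.
apply: filterS => t; rewrite ltr_pdivlMr// => xt; rewrite -linearB.
apply: le_lt_trans xt; apply: le_trans (fC _) _.
rewrite mulrC ler_wpM2l ?rnorm_ge0//.
by apply: le_trans (ler_norm _) _; rewrite lerDl.
Qed.

(** In the complex case [f x = g x - i (g (i x))].  The bound survives because
the value [f x] can be rotated onto the positive half-line, by a scalar of
modulus one applied to [x], and is then a value of [g]. *)
Lemma real_functional_lift (V : normedModType K) (g : V -> R) (C : R) :
  (forall x y, g (x + y) = g x + g y) ->
  (forall a x, g (of_re s a *: x) = a * g x) ->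
  (forall x, g x <= C * rnorm x) ->
  exists f : {linear V -> K^o}, (forall x, scalar_re (f x : K) = g x) /\
    forall x, scalar_re `|f x : K| <= C * rnorm x.
Proof.
move=> gD gZ gC.
suff [f [flin fg]] : exists f : V -> K^o,
    linear f /\ forall x, scalar_re (f x : K) = g x.
  pose F : {linear V -> K^o} := HB.pack f (GRing.isLinear.Build _ _ _ _ f flin).
  exists F; split=> // x.
  have [z0|z0] := eqVneq (F x : K) 0.
    rewrite z0 normr0; have := gC x; rewrite -fg -[f x]/(F x) z0.
    by rewrite scalar_re0.
  set z : K := F x in z0 *.
  have zn0 : `|z| != 0 by rewrite normr_eq0.
  have FZ c : F (c *: x) = c * z :> K by exact: linearZ_LR.
  have -> : `|z| = F ((`|z| / z) *: x) :> K by rewrite FZ divfK.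
  rewrite (fg _); apply: le_trans (gC _) _.
  rewrite rnormZ normrM normrV ?unitfE// normr_id divff//.
  by rewrite -[X in scalar_re X](of_re1 R s) of_reK mul1r.
case: s V g gD gZ gC => V g gD gZ gC.
  by exists g; split=> // a x y; rewrite gD gZ.
have gN x : g (- x) = - g x.
  by have := gZ (-1) x; rewrite of_reN of_re1 scaleN1r mulN1r.
exists (fun x => Complex (g x) (- g (Complex 0 1 *: x))); split=> // -[a b] x y.
have E t : Complex a b *: t = of_re ComplexScalars a *: t
    + of_re ComplexScalars b *: ('i%C *: t) :> V.
  rewrite scalerA -scalerDl; congr (_ *: _); apply/eqP.
  by rewrite eq_complex/=; apply/andP; split; apply/eqP; ring.
have iK t : 'i%C *: ('i%C *: t) = - t :> V.
  by rewrite scalerA -expr2 sqr_i scaleN1r.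
rewrite scalerDr scalerA [_ * Complex a b]mulrC -scalerA.
rewrite !gD !E !gD !gZ iK gN; apply/eqP; rewrite eq_complex/=.
by apply/andP; split; apply/eqP; ring.
Qed.

(** Zorn's lemma gives a maximal real-linear functional below the norm, whose
one-step extension property makes it total.  Partial functionals are encoded as
graphs [G] of pairs (vector, value); that a graph is single-valued follows from
domination by the norm.  Instead of prescribing the value [rnorm x0] at [x0],
the condition [dominated] demands that a further extension by this value stay
below the norm; on a total functional this forces the value. *)
Lemma norming_functional (V : normedModType K) (x0 : V) :
  exists f : {linear V -> K^o}, scalar_re (f x0 : K) = rnorm x0 /\
    forall x, scalar_re `|f x : K| <= rnorm x.
Proof.
pose dominated x r := forall t, r + t * rnorm x0 <= rnorm (x + of_re s t *: x0).
pose closed_graph (G : set (V * R)) := forall u v a, G u -> G v ->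
  G (of_re s a *: u.1 + v.1, a * u.2 + v.2).
pose P (G : set (V * R)) :=
  closed_graph G /\ forall u, G u -> dominated u.1 u.2.
have [G [[Gcl Gdom] Gmax]] : exists G, P G /\ forall B, G `<` B -> ~ P B.
  apply: Zorn_bigcup => F FP Ftot; split.
    move=> u v a [A FA Au] [B FB Bv].
    have [AB|BA] := Ftot _ _ FA FB.
    - by exists B => //; apply: (FP _ FB).1 => //; exact: AB.
    - by exists A => //; apply: (FP _ FA).1 => //; exact: BA.
  by move=> u [A FA Au]; exact: (FP _ FA).2.
have extend B : G `<=` B -> P B -> B `<=` G.
  move=> GB PB; apply: contrapT => nBG.
  exact: (Gmax B (conj GB nBG) PB).
have G0 : G (0, 0).
  apply: (extend (G `|` [set (0, 0)])); [by left| |by right]; split.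
    move=> u v a [Gu|->] [Gv|->]; last by right; rewrite /= scaler0 mulr0 !addr0.
    - by left; exact: Gcl.
    - left; rewrite /= !addr0.
      suff -> : (of_re s a *: u.1, a * u.2) =
          (of_re s (a - 1) *: u.1 + u.1, (a - 1) * u.2 + u.2) by exact: Gcl.
      congr (_, _); last by ring.
      by rewrite of_reD of_reN of_re1 scalerBl scale1r subrK.
    - by left; rewrite /= scaler0 mulr0 !add0r -surjective_pairing.
  move=> u [/Gdom//|->] t /=; rewrite !add0r rnormZ_re.
  by rewrite ler_wpM2r ?rnorm_ge0 ?ler_norm.
have GZ a u : G u -> G (of_re s a *: u.1, a * u.2).
  by move=> Gu; have := Gcl _ _ a Gu G0; rewrite /= !addr0.
have GD u v : G u -> G v -> G (u.1 + v.1, u.2 + v.2).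
  by move=> Gu Gv; have := Gcl _ _ 1 Gu Gv; rewrite of_re1 scale1r mul1r.
have Gfun x r r' : G (x, r) -> G (x, r') -> r = r'.
  suff H a b : G (x, a) -> G (x, b) -> a <= b.
    by move=> ? ?; apply/eqP; rewrite eq_le !H.
  move=> Ga Gb; have /Gdom/(_ 0) := GD _ _ Ga (GZ (-1) _ Gb).
  rewrite /= of_re0 scale0r mul0r !addr0 of_reN of_re1 scaleN1r subrr rnorm0.
  by rewrite mulN1r subr_le0.
have Gtot x1 : exists r, G (x1, r).
  (* [S] is the set of the lower bounds that domination of the extended graph
     imposes on a value at [x1]; the upper bounds imposed are the right-hand
     sides of [Sub] *)
  pose S := [set z | exists u t, G u /\ z = u.2 + t * rnorm x0 -
     rnorm (u.1 + of_re s t *: x0 - x1)].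
  have Sub u t z : G u -> S z ->
      z <= rnorm (u.1 + of_re s t *: x0 + x1) - (u.2 + t * rnorm x0).
    move=> Gu [v [t' [Gv ->]]].
    rewrite lerBrDr addrAC lerBlDr.
    have := Gdom _ (GD _ _ Gv Gu) (t' + t); rewrite /= => H.
    have -> : v.2 + t' * rnorm x0 + (u.2 + t * rnorm x0) =
       v.2 + u.2 + (t' + t) * rnorm x0 by ring.
    apply: le_trans H _; rewrite of_reD scalerDl addrACA.
    set A := v.1 + _; set B := u.1 + _.
    have -> : A + B = (A - x1) + (B + x1) by rewrite [B + x1]addrC subrKA.
    by rewrite [leRHS]addrC; exact: rnormD.
  have Sne : S !=set0 by eexists; exists (0, 0), 0; split.
  have Sbd : has_ubound S.
    exists (rnorm ((0 : V) + of_re s 0 *: x0 + x1) - (0 + 0 * rnorm x0)) => z.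
    exact: (Sub (0, 0) 0 z).
  pose r := sup S; exists r.
  have rlo u t : G u ->
      u.2 + t * rnorm x0 - rnorm (u.1 + of_re s t *: x0 - x1) <= r.
    by move=> Gu; apply: ub_le_sup => //; exists u, t.
  have rhi u t : G u ->
      r <= rnorm (u.1 + of_re s t *: x0 + x1) - (u.2 + t * rnorm x0).
    by move=> Gu; apply: ge_sup => // z Sz; exact: Sub.
  pose B := [set w : V * R |
    exists u a, G u /\ w = (u.1 + of_re s a *: x1, u.2 + a * r)].
  apply: (extend B).
  - move=> u Gu; exists u, 0; split => //.
    by rewrite of_re0 scale0r mul0r !addr0 -surjective_pairing.
  - split.
      move=> _ _ c [u [a [Gu ->]]] [v [b [Gv ->]]].
      exists (of_re s c *: u.1 + v.1, c * u.2 + v.2), (c * a + b).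
      split; first exact: Gcl.
      rewrite /= of_reD of_reM scalerDl scalerDr scalerA; congr (_, _).
        by rewrite addrACA.
      by ring.
    move=> _ [u [a [Gu ->]]] t /=.
    have [a0|a0|->] := ltrgtP a 0; last first.
    + by rewrite of_re0 scale0r mul0r !addr0; exact: Gdom.
    + have := rhi _ (a^-1 * t) (GZ a^-1 _ Gu); rewrite /= => H.
      have -> : u.1 + of_re s a *: x1 + of_re s t *: x0 =
        of_re s a *: (of_re s a^-1 *: u.1 + of_re s (a^-1 * t) *: x0 + x1).
        rewrite !scalerDr !scalerA -!of_reM mulrA divff ?gt_eqF// mul1r of_re1.
        by rewrite scale1r addrAC.
      rewrite rnormZ_re gtr0_norm//.
      move: H; rewrite lerBrDr -(ler_pM2l a0); apply: le_trans.
      by rewrite le_eqVlt; apply/orP; left; apply/eqP; field; rewrite gt_eqF.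
    + pose b := - a; have b0 : 0 < b by rewrite oppr_gt0.
      have -> : a = - b by rewrite opprK.
      have := rlo _ (b^-1 * t) (GZ b^-1 _ Gu); rewrite /= => H.
      have -> : u.1 + of_re s (- b) *: x1 + of_re s t *: x0 =
        of_re s b *: (of_re s b^-1 *: u.1 + of_re s (b^-1 * t) *: x0 - x1).
        rewrite !scalerDr !scalerA -!of_reM mulrA divff ?gt_eqF// mul1r of_re1.
        by rewrite scale1r addrAC scalerN of_reN scaleNr.
      rewrite rnormZ_re gtr0_norm//.
      move: H; rewrite lerBlDr -lerBlDl -(ler_pM2l b0); apply: le_trans.
      by rewrite le_eqVlt; apply/orP; left; apply/eqP; field; rewrite gt_eqF.
  - by exists (0, 0), 1; split => //; rewrite /= of_re1 scale1r mul1r !add0r.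
have /choice[g gG] := Gtot.
have gx0 : g x0 = rnorm x0.
  (* domination at [x0] with [t = -1] and at [- x0] with [t = 1] *)
  apply/eqP; rewrite eq_le; apply/andP; split.
    have := Gdom _ (gG x0) (-1); rewrite /= of_reN of_re1 scaleN1r subrr rnorm0.
    by rewrite mulN1r subr_le0.
  have := Gdom _ (GZ (-1) _ (gG x0)) 1.
  rewrite /= of_reN of_re1 scaleN1r scale1r addNr rnorm0 mulN1r mul1r addrC.
  by rewrite subr_le0.
have gD x y : g (x + y) = g x + g y.
  by apply: Gfun (gG _) _; exact: (GD _ _ (gG x) (gG y)).
have gZ a x : g (of_re s a *: x) = a * g x.
  by apply: Gfun (gG _) _; exact: (GZ _ _ (gG x)).
have gle x : g x <= 1 * rnorm x.
  have := Gdom _ (gG x) 0.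
  by rewrite /= mul0r of_re0 scale0r !addr0 mul1r.
have [f [fg fle]] := real_functional_lift gD gZ gle.
by exists f; split=> [|x]; [rewrite fg|rewrite -[leRHS]mul1r].
Qed.

End BoundedLinear.

(** * Bounded bilinear maps and the projective norm *)

Section BilinearMaps.
Variables (R : realType) (s : scalar_kind).
Notation K := (scalars R s).

Definition bilinear_map (X Y Z : lmodType K) (b : X -> Y -> Z) :=
  (forall y, linear (b^~ y)) /\ (forall x, linear (b x)).

Definition bounded_map (V W : normedModType K) (f : V -> W) :=
  exists C, forall x, rnorm (f x) <= C * rnorm x.

Lemma linear_pack (V W : lmodType K) (f : V -> W) :
  linear f -> exists F : {linear V -> W}, forall x, F x = f x.
Proof.
move=> flin.
pose F : {linear V -> W} := HB.pack f (GRing.isLinear.Build _ _ _ _ f flin).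
by exists F.
Qed.

Lemma bilinear_map_bilinear (X Y Z : lmodType K) (b : {bilinear X -> Y -> Z}) :
  bilinear_map b.
Proof.
by split=> [y|x] a u v; [rewrite linearPl|rewrite linearPr].
Qed.

Lemma bilinear_map_comp (X Y Z W : lmodType K) (b : X -> Y -> Z)
    (f : {linear Z -> W}) :
  bilinear_map b -> bilinear_map (fun x y => f (b x y)).
Proof.
by move=> [bl br]; split=> [y|x] a u v; rewrite (bl, br) linearP.
Qed.

Lemma bilinear_map0l (X Y Z : lmodType K) (b : X -> Y -> Z) y :
  bilinear_map b -> b 0 y = 0.
Proof.
move=> [bl _]; have := bl y (-1) 0 0.
by rewrite /= scaler0 addr0 scaleN1r addNr.
Qed.

Lemma bilinear_map0r (X Y Z : lmodType K) (b : X -> Y -> Z) x :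
  bilinear_map b -> b x 0 = 0.
Proof.
move=> [_ br]; have := br x (-1) 0 0.
by rewrite /= scaler0 addr0 scaleN1r addNr.
Qed.

Lemma bilinear_map_sumZ (X Y Z : lmodType K) (b : X -> Y -> Z) (a : K)
    (t : seq (X * Y)) : bilinear_map b ->
  \sum_(z <- [seq (a *: w.1, w.2) | w <- t]) b z.1 z.2
    = a *: \sum_(z <- t) b z.1 z.2.
Proof.
move=> bb; rewrite big_map scaler_sumr; apply: eq_bigr => z _ /=.
have [bl _] := bb.
by have := bl z.2 a z.1 0; rewrite /= addr0 bilinear_map0l// addr0.
Qed.

Lemma same_tensor_bilinear (X Y : normedModType K) (b : X -> Y -> K^o)
    (t t' : seq (X * Y)) : bilinear_map b -> same_tensor t t' ->
  \sum_(z <- t) b z.1 z.2 = \sum_(z <- t') b z.1 z.2.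
Proof.
move=> bb; pose B : {bilinear X -> Y -> K^o} :=
  HB.pack b (bilinear_isBilinear.Build _ _ _ _ _ _ b bb).
by move=> /(_ B).
Qed.

Lemma rnorm_small_eq0 (V : normedModType K) (C : R) (x : V) :
  (forall e, 0 < e -> rnorm x <= C * e) -> x = 0.
Proof.
move=> H; apply: rnorm_eq0; apply/eqP; rewrite eq_le rnorm_ge0 andbT.
apply/ler_addgt0Pr => e e0; rewrite add0r.
have C0 : 0 < `|C| + 1 by rewrite ltr_wpDl.
apply: le_trans (H (e / (`|C| + 1)) _) _; first by rewrite divr_gt0.
rewrite mulrA ler_pdivrMr// mulrC ler_wpM2l//; first exact: ltW.
by apply: le_trans (ler_norm _) _; rewrite lerDl.
Qed.

Lemma bounded_map_comp (U V W : normedModType K) (f : V -> W) (g : U -> V) :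
  bounded_map f -> bounded_map g -> bounded_map (f \o g).
Proof.
move=> [C fC] [D gD]; exists (`|C| * D) => x /=; apply: le_trans (fC _) _.
apply: (@le_trans _ _ (`|C| * rnorm (g x))).
  by rewrite ler_wpM2r ?rnorm_ge0 ?ler_norm.
by rewrite -mulrA ler_wpM2l.
Qed.

Lemma bounded_mapD (V W : normedModType K) (f g : V -> W) :
  bounded_map f -> bounded_map g -> bounded_map (f \+ g).
Proof.
move=> [C fC] [D gD]; exists (C + D) => x; apply: le_trans (rnormD _ _) _.
by rewrite mulrDl lerD.
Qed.

Lemma bounded_mapB (V W : normedModType K) (f g : V -> W) :
  bounded_map f -> bounded_map g -> bounded_map (f \- g).
Proof.
move=> [C fC] [D gD]; exists (C + D) => x; apply: le_trans (rnormD _ _) _.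
by rewrite rnormN mulrDl lerD.
Qed.

End BilinearMaps.

Section ProjectiveTensorProduct.
Variables (R : realType) (s : scalar_kind).
Notation K := (scalars R s).
Variables (X Y : normedModType K) (T : completeNormedModType K).
Variables (tens : {bilinear X -> Y -> T}) (hT : projective_tensor_product tens).

Let cost (t : seq (X * Y)) := \sum_(z <- t) rnorm z.1 * rnorm z.2.

Lemma rnorm_tens x y : rnorm (tens x y) <= rnorm x * rnorm y.
Proof.
have := hT.1 [:: (x, y)]; rewrite big_seq1 => ->.
apply: ge_inf; last first.
  by exists [:: (x, y)] => //; rewrite big_seq1.
exists 0 => _ [t _ <-].
by apply: sumr_ge0 => z _; rewrite mulr_ge0 ?rnorm_ge0.
Qed.

Lemma tens_dense (u : T) (e : R) : 0 < e ->
  exists t : seq (X * Y), rnorm (u - \sum_(z <- t) tens z.1 z.2) < e.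
Proof.
move=> e0; have e0' : 0 < of_re s e by rewrite -(of_re0 R s) of_re_lt.
have [||w [bu [t _ tu]]] := hT.2 (ball u (of_re s e)).
- by exists u; exact: ballxx.
- exact: ball_open.
by exists t; move: bu; rewrite -tu -ball_normE /= -rnormE of_re_lt.
Qed.

Section Extension.
Variables (Z : normedModType K) (b : X -> Y -> Z) (M : R).
Hypotheses (bb : bilinear_map b) (M0 : 0 <= M).
Hypothesis bM : forall x y, rnorm (b x y) <= M * (rnorm x * rnorm y).

(** A functional norming the sum on the left, composed with [b], is a bilinear
form; hence that sum may be computed from every sequence representing the same
tensor, and it is at most [M] times the cost of each of them. *)
Lemma rnorm_tensor_sum t :
  rnorm (\sum_(z <- t) b z.1 z.2) <= M * rnorm (\sum_(z <- t) tens z.1 z.2).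
Proof.
rewrite hT.1; set w := \sum_(z <- t) b z.1 z.2.
have [f [fw fle]] := norming_functional w.
have wle t' : same_tensor t t' -> rnorm w <= M * cost t'.
  move=> tt'; rewrite -fw /w linear_sum.
  rewrite (same_tensor_bilinear (bilinear_map_comp f bb) tt').
  rewrite -(linear_sum f) /=; apply: le_trans (ler_norm _) _.
  apply: le_trans (ler_scalar_re _) _; apply: le_trans (fle _) _.
  apply: le_trans (rnorm_sum _ _) _; rewrite mulr_sumr.
  by apply: ler_sum => z _; exact: bM.
have [M00|Mn0] := eqVneq M 0.
  by have := wle t (fun=> erefl); rewrite M00 !mul0r.
have Mpos : 0 < M by rewrite lt0r Mn0.
rewrite mulrC -ler_pdivrMr//; apply: lb_le_inf.
  by exists (cost t); exists t.
by move=> _ [t' tt' <-]; rewrite ler_pdivrMr// mulrC; exact: wle.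
Qed.

Lemma rnorm_tensor_sumB t t' :
  rnorm (\sum_(z <- t) b z.1 z.2 - \sum_(z <- t') b z.1 z.2)
    <= M * rnorm (\sum_(z <- t) tens z.1 z.2 - \sum_(z <- t') tens z.1 z.2).
Proof.
have := rnorm_tensor_sum (t ++ [seq (-1 *: w.1, w.2) | w <- t']).
rewrite !big_cat/= !bilinear_map_sumZ ?scaleN1r//.
exact: bilinear_map_bilinear.
Qed.

End Extension.

(** By density, a bounded operator on [T] obeys any bound that it obeys on
elementary tensors; the constant in [bounded_map L] may be arbitrarily large. *)
Lemma tens_bound (Z : normedModType K) (L : {linear T -> Z}) (M : R) :
  bounded_map L -> 0 <= M ->
  (forall x y, rnorm (L (tens x y)) <= M * (rnorm x * rnorm y)) ->
  forall u, rnorm (L u) <= M * rnorm u.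
Proof.
move=> [C LC] M0 LM u; apply/ler_addgt0Pr => e e0.
have D0 : 0 < `|C| + M + 1 by rewrite ltr_wpDl// addr_ge0.
have [t ut] := tens_dense u (divr_gt0 e0 D0).
set v := \sum_(z <- t) _ in ut.
have Lv : rnorm (L v) <= M * rnorm v.
  rewrite /v linear_sum; apply: (rnorm_tensor_sum _ M0 LM).
  exact/bilinear_map_comp/bilinear_map_bilinear.
have vu : rnorm v <= rnorm u + rnorm (u - v).
  by have := rnormD u (v - u); rewrite (rnormB v) subrKC.
have -> : L u = L (u - v) + L v by rewrite -linearD subrK.
apply: le_trans (rnormD _ _) _.
have H1 : rnorm (L (u - v)) <= `|C| * rnorm (u - v).
  by apply: le_trans (LC _) _; rewrite ler_wpM2r ?rnorm_ge0 ?ler_norm.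
have H2 : M * rnorm v <= M * rnorm u + M * rnorm (u - v).
  by rewrite -mulrDr ler_wpM2l.
have H3 : (`|C| + M) * rnorm (u - v) <= e.
  move: ut; rewrite ltr_pdivlMr// => /ltW; apply: le_trans.
  by rewrite mulrC ler_wpM2l ?rnorm_ge0// lerDl.
by move: H3; rewrite mulrDl => H3; lra.
Qed.

Lemma tens_ext (Z : normedModType K) (L L' : {linear T -> Z}) :
  bounded_map L -> bounded_map L' ->
  (forall x y, L (tens x y) = L' (tens x y)) -> forall u, L u = L' u.
Proof.
move=> Lb Lb' LL' u; apply/eqP; rewrite -subr_eq0; apply/eqP.
apply: rnorm_eq0; apply/eqP; rewrite eq_le rnorm_ge0 andbT -[leRHS](mul0r (rnorm u)).
apply: (@tens_bound _ (L \- L')%R) => // [|x y].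
  exact: bounded_mapB.
by rewrite /= LL' subrr rnorm0 mul0r.
Qed.

(** The values on finite sums of elementary tensors depend on these in a
Lipschitz way, so completeness of [Z] extends them to [T].  The value at [u] is
described as the [z] whose distance to the image of every finite sum is at most
[M] times the distance of [u] to that sum; linearity and the bound are read off
from this description. *)
Lemma tens_lift (Z : completeNormedModType K) (b : X -> Y -> Z) (M : R) :
  bilinear_map b -> 0 <= M ->
  (forall x y, rnorm (b x y) <= M * (rnorm x * rnorm y)) ->
  exists L : {linear T -> Z}, (forall x y, L (tens x y) = b x y) /\
    forall u, rnorm (L u) <= M * rnorm u.
Proof.
move=> bb M0 bM.
pose S t := \sum_(z <- t) tens z.1 z.2; pose B t := \sum_(z <- t) b z.1 z.2.
have SB t t' : rnorm (B t - B t') <= M * rnorm (S t - S t').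
  exact: rnorm_tensor_sumB.
have ex u : exists z, forall t, rnorm (z - B t) <= M * rnorm (u - S t).
  have /choice[t ut] : forall n : nat, exists t, rnorm (u - S t) < n.+1%:R^-1.
    by move=> n; apply: tens_dense.
  have small e : 0 < e ->
      exists N, forall n, (N <= n)%N -> M * rnorm (u - S (t n)) <= e.
    move=> e0; have M10 : 0 < M + 1 by rewrite ltr_wpDl.
    have [N HN] : exists N, N.+1%:R^-1 < e / (M + 1).
      exists (Num.truncn ((e / (M + 1))^-1)).
      rewrite invf_plt ?posrE ?divr_gt0// ?truncnS_gt//.
    exists N => n Nn; have : rnorm (u - S (t n)) <= e / (M + 1).
      apply: le_trans (ltW (ut n)) _; apply: le_trans _ (ltW HN).
      by rewrite lef_pV2 ?posrE// ler_nat.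
    rewrite ler_pdivlMr//; apply: le_trans.
    by rewrite mulrC ler_wpM2l ?rnorm_ge0// lerDl.
  have Bcvg : cvg ((fun n => B (t n)) @ \oo).
    apply: cauchy_seq_cvg => e e0.
    have [N HN] := small _ (divr_gt0 e0 (ltr0Sn _ 1)).
    exists N => n m Nn Nm; apply: le_trans (SB _ _) _.
    have := HN _ Nn; have := HN _ Nm.
    have := ler_wpM2l M0 (rnorm_triangle (S (t n)) u (S (t m))).
    by rewrite mulrDr (rnormB (S (t n)) u); lra.
  exists (lim ((fun n => B (t n)) @ \oo)) => t'.
  apply/ler_addgt0Pr => e e0; have e20 := divr_gt0 e0 (ltr0Sn R 1).
  have [N HN] := small _ e20.
  have [N' HN'] := (cvg_seq_rnormP _ _).1 Bcvg _ e20.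
  set z := lim _ in HN' *; pose n := maxn N N'.
  have := HN n (leq_maxl _ _); have := HN' n (leq_maxr _ _).
  have := rnorm_triangle z (B (t n)) (B t').
  have := SB (t n) t'.
  have := ler_wpM2l M0 (rnorm_triangle (S (t n)) u (S t')).
  by rewrite mulrDr (rnormB (S (t n)) u); lra.
have /choice[L LB] := ex.
have Llin : linear L.
  move=> a u v; apply/eqP; rewrite -subr_eq0; apply/eqP.
  set na := scalar_re `|a|.
  have na0 : 0 <= na := scalar_re_norm_ge0 a.
  apply: (@rnorm_small_eq0 _ _ _ (2 * (na + 1) * M)) => e e0.
  have [t ut] := tens_dense u e0; have [t' vt'] := tens_dense v e0.
  pose tt := [seq (a *: w.1, w.2) | w <- t] ++ t'.
  have Stt : S tt = a *: S t + S t'.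
    rewrite /S big_cat/= bilinear_map_sumZ//; exact: bilinear_map_bilinear.
  have Btt : B tt = a *: B t + B t' by rewrite /B big_cat/= bilinear_map_sumZ.
  have H1 := LB (a *: u + v) tt.
  have H2 := LB u t; have H3 := LB v t'.
  have {}H1 : rnorm (L (a *: u + v) - B tt) <= M * ((na + 1) * e).
    apply: le_trans H1 _; rewrite ler_wpM2l// Stt opprD addrACA -scalerBr.
    apply: le_trans (rnormD _ _) _; rewrite rnormZ mulrDl mul1r.
    by apply: lerD; [rewrite ler_wpM2l// ltW|exact: ltW].
  have {}H2 : rnorm (L u - B t) <= M * e.
    by apply: le_trans H2 _; rewrite ler_wpM2l// ltW.
  have {}H3 : rnorm (L v - B t') <= M * e.
    by apply: le_trans H3 _; rewrite ler_wpM2l// ltW.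
  apply: le_trans (rnorm_triangle _ (B tt) _) _.
  have : rnorm (B tt - (a *: L u + L v)) <= na * (M * e) + M * e.
    rewrite Btt opprD addrACA -scalerBr.
    apply: le_trans (rnormD _ _) _; rewrite rnormZ !(rnormB (B _)).
    by apply: lerD => //; rewrite ler_wpM2l.
  by move: H1; rewrite !mulrDl !mulrDr mul1r; nra.
have [F FL] := linear_pack Llin.
exists F; split=> [x y|u]; rewrite FL.
  have := LB (tens x y) [:: (x, y)]; rewrite /S /B !big_seq1 subrr rnorm0 mulr0.
  move=> H; apply/eqP; rewrite -subr_eq0; apply/eqP/rnorm_eq0.
  by apply/eqP; rewrite eq_le rnorm_ge0 andbT.
by have := LB u [::]; rewrite /S /B !big_nil !subr0.
Qed.

End ProjectiveTensorProduct.

(** * Finite-rank operators *)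

Section FiniteRank.
Variables (R : realType) (s : scalar_kind).
Notation K := (scalars R s).
Variable X : normedModType K.

(** The operators [x |-> sum_k f_k x *: e_k].  Generating them by adding one
term at a time makes induction on the number of terms available. *)
Inductive finite_rank : (X -> X) -> Prop :=
| finite_rank0 : finite_rank (fun=> 0)
| finite_rank_add A (f : {linear X -> K^o}) e :
    finite_rank A -> bounded_map f -> finite_rank (fun x => A x + f x *: e).

Lemma finite_rank_linear A : finite_rank A -> linear A.
Proof.
elim=> [|{}A f e _ Alin _] a x y; first by rewrite scaler0 addr0.
rewrite Alin linearP scalerDr scalerDl addrACA; congr (_ + (_ + _)).
by rewrite scalerA.
Qed.

Lemma finite_rank_bounded A : finite_rank A -> bounded_map A.
Proof.
elim=> [|{}A f e _ [C AC] [D fD]].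
  by exists 0 => x; rewrite rnorm0 mul0r.
exists (C + D * rnorm e) => x; apply: le_trans (rnormD _ _) _.
rewrite mulrDl rnormZ lerD// mulrAC ler_wpM2r ?rnorm_ge0//.
exact: fD.
Qed.

Lemma finite_rank_sum A B :
  finite_rank A -> finite_rank B -> finite_rank (fun x => A x + B x).
Proof.
move=> Afr; elim=> [|{}B f e _ IH fb].
  by under eq_fun do rewrite addr0.
by under eq_fun do rewrite addrA; exact: finite_rank_add.
Qed.

Lemma finite_rank_comp A (B : {linear X -> X}) :
  finite_rank A -> bounded_map B -> finite_rank (fun x => A (B x)).
Proof.
move=> Afr Bb; elim: Afr => [|{}A f e _ IH fb]; first exact: finite_rank0.
apply: (@finite_rank_add _ (f \o B)%FUN) => //.
have [C BC] := Bb; have [D fD] := fb.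
exists (`|D| * C) => x; apply: le_trans (fD _) _ => /=.
apply: (@le_trans _ _ (`|D| * rnorm (B x))).
  by rewrite ler_wpM2r ?rnorm_ge0 ?ler_norm.
by rewrite -mulrA ler_wpM2l.
Qed.

(** Vectors are added one at a time: if [Q] projects onto the span of the
previous ones and [v := e - Q e] is nonzero, then a functional [h] with
[h v = 1], corrected to [g := h - h \o Q] so that it vanishes on the range of
[Q], gives the projection [Q + g v], which also fixes [e].  Continuity of the
coordinates is thus built in by Hahn-Banach. *)
Lemma finite_rank_projection (es : seq X) : exists Q,
  [/\ finite_rank Q, forall x, Q (Q x) = Q x & forall e, e \in es -> Q e = e].
Proof.
elim: es => [|e es [Q [Qfr QQ Qes]]].
  by exists (fun=> 0); split=> //; exact: finite_rank0.
have [q qQ] := linear_pack (finite_rank_linear Qfr).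
pose v := e - q e.
have qv : q v = 0 by rewrite /v linearB/= !qQ QQ subrr.
have [v0|v0] := eqVneq v 0.
  exists Q; split=> // x; rewrite inE => /predU1P[->|/Qes//].
  by apply/esym/eqP; rewrite -subr_eq0 -qQ; apply/eqP.
have [f [fv fle]] := norming_functional v.
have fv0 : (f v : K) != 0.
  by apply: contra_neq v0 => fv0; apply: rnorm_eq0; rewrite -fv fv0 scalar_re0.
pose g x : K^o := ((f v : K)^-1 *: (f x - f (q x)) : K^o).
have glin : linear g.
  move=> a x y; rewrite /g (linearP q) !(linearP f) opprD addrACA -scalerBr scalerDr.
  by rewrite !scalerA mulrC.
have [G Gg] := linear_pack glin.
have Gv : G v = 1 :> K.
  by rewrite Gg /g qv linear0 subr0 /GRing.scale/= mulVf.
have Gq x : G (q x) = 0 :> K.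
  by rewrite Gg /g !qQ QQ subrr scaler0.
have Ge : G e = 1 :> K.
  by rewrite -Gv /v linearB/= Gq subr0.
exists (fun x => Q x + G x *: v); split.
- apply: finite_rank_add => //.
  have [C QC] := finite_rank_bounded Qfr.
  exists (scalar_re `|(f v : K)^-1| * (1 + C)) => x; rewrite Gg /g.
  rewrite rnormZ -mulrA ler_wpM2l ?scalar_re_norm_ge0//.
  apply: le_trans (rnormD _ _) _; rewrite rnormN mulrDl mul1r.
  apply: lerD; first exact: fle.
  by apply: le_trans (fle _) _; rewrite qQ.
- move=> x; rewrite -!qQ (linearD q) (linearZ_LR q) qv scaler0 addr0.
  rewrite (linearD G) (linearZ_LR G) Gq Gv add0r /GRing.scale/= mulr1.
  by rewrite [q (q x)]qQ !qQ QQ.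
- move=> x; rewrite inE => /predU1P[->|xes].
    by rewrite Ge scale1r -qQ subrKC.
  by rewrite -{2}(Qes _ xes) -qQ Gq scale0r addr0 qQ Qes.
Qed.

Lemma finite_dimensional_projection (A : set X) : finite_dimensional A ->
  exists Q, finite_rank Q /\ forall x, A x -> Q x = x.
Proof.
move=> [n [e ->]].
have [Q [Qfr _ Qe]] := finite_rank_projection [seq e k | k <- enum 'I_n].
exists Q; split=> // _ [a _ <-].
have [q qQ] := linear_pack (finite_rank_linear Qfr).
rewrite -qQ linear_sum; apply: eq_bigr => k _.
by rewrite linearZ/= qQ Qe// map_f// mem_enum.
Qed.

End FiniteRank.

(** * Projections of an unconditional decomposition *)

Section Decomposition.
Variables (R : realType) (s : scalar_kind).
Notation K := (scalars R s).
Variables (X : normedModType K) (I : choiceType) (Xs : I -> set X).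
Hypothesis hX : unconditional_decomposition Xs.

Local Notation P := (decomposition_proj Xs).

(** With [expansion_unique], this characterizes the coordinates of [x], which
gives all algebraic properties of the coordinate projections: one exhibits a
convergent expansion. *)
Lemma expansion_proj x : expansion Xs x (fun i => P i x).
Proof.
have [a [ax _]] := hX.2 x.
by have := xgetPex (fun=> 0) (ex_intro _ a ax).
Qed.

Lemma expansion_unique x a : expansion Xs x a -> forall i, P i x = a i.
Proof.
move=> ax i; have [b [_ bu]] := hX.2 x.
by rewrite -(bu _ ax) -[LHS]/((fun i => P i x) i) -(bu _ (expansion_proj x)).
Qed.

Lemma proj_linear i : linear (P i).
Proof.
move=> a x y; apply: (@expansion_unique _ (fun i => a *: P i x + P i y)).
have [xX xc] := expansion_proj x; have [yX yc] := expansion_proj y.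
split=> [j|]; first by have [_ _ sub] := hX.1 j; apply: sub.
have -> : partial_sum (fun i => a *: P i x + P i y) =
    (fun F => a *: partial_sum (fun i => P i x) F + partial_sum (fun i => P i y) F).
  by apply/funext => F; rewrite /partial_sum big_split/= -scaler_sumr.
by exact: (cvgD (cvgZ (cvg_cst a) xc) yc).
Qed.

Lemma proj_ne i j x : Xs j x -> i != j -> P i x = 0.
Proof.
move=> xj ij; pose a k := if k == j then x else 0.
rewrite (@expansion_unique x a) /a ?(negbTE ij)//; split=> [k|].
  by case: eqP => [->//|_]; have [_ ? _] := hX.1 k.
apply: cvg_near_cst; exists [fset j]%fset => // F /=.
rewrite fsub1set => jF.
rewrite /partial_sum (bigD1 [` jF]%fset)//= eqxx big1 ?addr0// => k kj.
case: eqP => // kj'; case/eqP: kj; exact: val_inj.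
Qed.

Definition proj_on (F : {fset I}) (x : X) : X := \sum_(i <- F) P i x.

Lemma proj_on_linear F : linear (proj_on F).
Proof.
move=> a x y; rewrite /proj_on scaler_sumr -big_split; apply: eq_bigr => i _.
exact: proj_linear.
Qed.

Lemma proj_on_disjoint F G x :
  [disjoint F & G]%fset -> proj_on F (proj_on G x) = 0.
Proof.
move=> FG; rewrite /proj_on big_seq big1// => i iF.
have [L LP] := linear_pack (proj_linear i).
rewrite -LP linear_sum big_seq big1// => j jG; rewrite LP.
apply: (@proj_ne _ j); first exact: (expansion_proj x).1.
by apply: contraTneq jG => <-; exact: (fdisjointP FG).
Qed.

Lemma proj_onD F G x : (G `<=` F)%fset ->
  proj_on (F `\` G)%fset x = proj_on F x - proj_on G x.
Proof.
move=> GF.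
have [FG FG'] : [fset i in F | i \in G]%fset = G /\
    [fset i in F | i \notin G]%fset = (F `\` G)%fset.
  split; apply/fsetP => i; rewrite !inE/= 1?andbC//.
  by apply: andb_idr => /(fsubsetP GF).
suff -> : proj_on F x = proj_on G x + proj_on (F `\` G)%fset x.
  by rewrite [X in X - _]addrC addrK.
by rewrite /proj_on (big_fsetID _ (mem G))/= FG FG'.
Qed.

Lemma proj_on_cvg x e : 0 < e -> exists F0, forall F : {fset I}, (F0 `<=` F)%fset ->
  rnorm (x - proj_on F x) < e.
Proof.
move=> e0; have [_ /cvg_rnormP/(_ _ e0)[F0 _ H]] := expansion_proj x.
exists F0 => F /H /=; rewrite /partial_sum /proj_on.
by rewrite big_seq_fsetE.
Qed.

Lemma proj_on1 i x : proj_on [fset i]%fset x = P i x.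
Proof. by rewrite /proj_on big_seq_fset1. Qed.

Variables (p : R).
Hypothesis p0 : 0 < p.

(** The lower estimate for a family consisting of one set. *)
Lemma proj_on_bounded : disjoint_lower_estimate Xs p ->
  exists2 C, 0 <= C & forall F x, rnorm (proj_on F x) <= C * rnorm x.
Proof.
move=> [c c0 H]; exists c; first exact: ltW.
move=> F x; have := H 1%N (fun=> F) _ x.
rewrite big_ord1 -powRrM mulfV ?gt_eqF// powRr1 ?rnorm_ge0//; apply.
by move=> k l; rewrite !ord1.
Qed.

Lemma finite_rank_proj_on F :
  (forall i, finite_dimensional (Xs i)) ->
  (exists2 C, 0 <= C & forall F x, rnorm (proj_on F x) <= C * rnorm x) ->
  finite_rank (proj_on F).
Proof.
move=> fin [C _ HC]; rewrite /proj_on.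
elim: (enum_fset F) => [|i r IH].
  by under eq_fun do rewrite big_nil; exact: finite_rank0.
under eq_fun do rewrite big_cons; apply: finite_rank_sum IH.
have [Q [Qfr QXs]] := finite_dimensional_projection (fin i).
have [L LP] := linear_pack (proj_linear i).
have -> : P i = fun x => Q (L x).
  apply/funext => x; rewrite LP QXs//; exact: (expansion_proj x).1.
apply: finite_rank_comp => //; exists C => x.
by rewrite LP -proj_on1.
Qed.

End Decomposition.

(** * Weakly null sequences and tensor products *)

Section WeaklyNull.
Variables (R : realType) (s : scalar_kind).
Notation K := (scalars R s).

Lemma weakly_cvg_bounded (V W : normedModType K) (L : {linear V -> W}) u :
  bounded_map L -> weakly_cvg u 0 -> weakly_cvg (L \o u) 0.
Proof.
move=> [C LC] u0 f fc; have := u0 (f \o L)%FUN.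
rewrite !linear0; apply => x; apply: continuous_comp; last exact: fc.
exact: rnorm_bounded_continuous LC x.
Qed.

Lemma bounded_cvg0 (V W : normedModType K) (L : {linear V -> W}) (u : nat -> V) :
  bounded_map L -> u @ \oo --> (0 : V) -> (L \o u) @ \oo --> (0 : W).
Proof.
move=> [C LC] u0; rewrite -(linear0 L); apply: continuous_cvg => //.
exact: rnorm_bounded_continuous LC 0.
Qed.

(** The norm limit provided by the Schur property is the weak limit, since
functionals separate points. *)
Lemma schur_null (V : normedModType K) (u : nat -> V) :
  schur V -> weakly_cvg u 0 -> u @ \oo --> (0 : V).
Proof.
move=> sV u0; have uc := sV _ _ u0.
suff <- : lim (u @ \oo) = 0 by [].
have [f [fl fle]] := norming_functional (lim (u @ \oo)).
apply: rnorm_eq0; rewrite -fl.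
have fc : continuous f.
  by apply: (@rnorm_bounded_continuous _ _ _ _ _ 1) => x; rewrite mul1r; exact: fle.
have flim : (f \o u) @ \oo --> f (lim (u @ \oo)) by exact: cvg_comp uc (fc _).
have -> : f (lim (u @ \oo)) = 0.
  have f0 := u0 f fc; rewrite linear0 in f0.
  exact: (cvg_unique _ flim f0).
exact: scalar_re0.
Qed.

(** The universal property of the projective tensor product is isolated because
it is symmetric in the two factors: what is proved from it for operators on one
factor holds for the other. *)
Definition universal_tensor (V W T : normedModType K) (b : V -> W -> T) :=
  [/\ bilinear_map b,
      forall x y, rnorm (b x y) <= rnorm x * rnorm y,
      forall (Z : completeNormedModType K) (c : V -> W -> Z) (M : R),
        bilinear_map c -> 0 <= M ->
        (forall x y, rnorm (c x y) <= M * (rnorm x * rnorm y)) ->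
        exists L : {linear T -> Z}, (forall x y, L (b x y) = c x y) /\
          bounded_map L
    & forall (Z : normedModType K) (L L' : {linear T -> Z}),
        bounded_map L -> bounded_map L' ->
        (forall x y, L (b x y) = L' (b x y)) -> forall u, L u = L' u].

Lemma universal_tensor_tens (X Y : normedModType K)
    (T : completeNormedModType K) (tens : {bilinear X -> Y -> T}) :
  projective_tensor_product tens -> universal_tensor tens.
Proof.
move=> hT; split.
- exact: bilinear_map_bilinear.
- exact: rnorm_tens.
- move=> Z c M cb M0 cM; have [L [Lc LM]] := tens_lift hT cb M0 cM.
  by exists L; split=> //; exists M.
- by move=> Z L L'; exact: tens_ext.
Qed.

Lemma universal_tensor_sym (V W T : normedModType K) (b : V -> W -> T) :
  universal_tensor b -> universal_tensor (fun y x => b x y).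
Proof.
move=> [[bl br] b1 lift ext]; split=> //.
- by move=> x y; rewrite mulrC.
- move=> Z c M [cl cr] M0 cM; have [||L [Lc Lb]] := lift Z (fun x y => c y x) M _ M0.
  + by split.
  + by move=> x y; rewrite [rnorm x * _]mulrC.
  + by exists L.
- by move=> Z L L' Lb L'b LL'; exact: ext.
Qed.

(** For [A x = sum_k f_k x *: e_k], the operator [A (x) id] factors as
[u |-> sum_k e_k (x) (f_k (x) id) u] through finitely many copies of [W], where
weakly null sequences are norm null. *)
Lemma finite_rank_weakly_null (V : normedModType K) (W T : completeNormedModType K)
    (b : V -> W -> T) (A : V -> V) (L : {linear T -> T}) (u : nat -> T) :
  universal_tensor b -> schur W -> finite_rank A -> bounded_map L ->
  (forall x y, L (b x y) = b (A x) y) ->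
  weakly_cvg u 0 -> (L \o u) @ \oo --> (0 : T).
Proof.
move=> [bb b1 lift ext] sW Afr Lb Lt u0.
elim: Afr L Lb Lt => [|{}A f e Afr IH [D fD]] L Lb Lt.
  have L0 v : L v = 0.
    apply: (ext _ L \0%R) => // [|x y]; last by rewrite Lt bilinear_map0l.
    by exists 0 => x; rewrite /= rnorm0 mul0r.
  by rewrite (_ : L \o u = fun=> 0); [exact: cvg_cst|apply/funext => n; exact: L0].
have [C AC] := finite_rank_bounded Afr.
have Alin := finite_rank_linear Afr.
have [] := lift T (fun x y => b (A x) y) `|C|.
- by split=> [y|x] a v w; [rewrite Alin bb.1|rewrite bb.2].
- by [].
- move=> x y; apply: le_trans (b1 _ _) _; rewrite mulrA ler_wpM2r ?rnorm_ge0//.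
  by apply: le_trans (AC _) _; rewrite ler_wpM2r ?rnorm_ge0 ?ler_norm.
move=> LA [LAt LAb].
have [] := lift W (fun x y => (f x : K) *: y) `|D|.
- split=> [y|x] a v w; first by rewrite linearP scalerDl scalerA.
  by rewrite scalerDr !scalerA mulrC.
- by [].
- move=> x y; rewrite rnormZ mulrA ler_wpM2r ?rnorm_ge0//.
  by apply: le_trans (fD _) _; rewrite ler_wpM2r ?rnorm_ge0 ?ler_norm.
move=> Lf [Lft Lfb].
have [E bE] := linear_pack (bb.2 e).
have Eb : bounded_map E by exists (rnorm e) => y; rewrite bE.
have LE v : L v = LA v + E (Lf v).
  apply: (ext _ L (LA \+ (E \o Lf))%R) => // [|x y].
    exact: bounded_mapD LAb (bounded_map_comp Eb Lfb).
  rewrite Lt /= LAt Lft bE.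
  have [bl br] := bb.
  have /= := bl y 1 (A x) (f x *: e); rewrite !scale1r => ->; congr (_ + _).
  have /= := bl y (f x) e 0; rewrite addr0 bilinear_map0l// addr0 => ->.
  by have /= := br e (f x) y 0; rewrite addr0 bilinear_map0r// addr0 => ->.
have H1 := IH _ LAb LAt.
have H2 : (Lf \o u) @ \oo --> (0 : W).
  by apply: schur_null => //; exact: weakly_cvg_bounded.
have H3 := bounded_cvg0 Eb H2.
have -> : L \o u = (LA \o u) + (E \o (Lf \o u)).
  by apply/funext => n; exact: LE.
have : ((LA \o u) + (E \o (Lf \o u)))%R @ \oo --> (0 + 0 : T) by exact: cvgD.
by rewrite addr0.
Qed.

End WeaklyNull.

Section Operators.
Variables (R : realType) (s : scalar_kind).
Notation K := (scalars R s).

Variables (X Y : normedModType K) (T : completeNormedModType K).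
Variables (tens : {bilinear X -> Y -> T}) (hT : projective_tensor_product tens).

Lemma tens_operator (A : X -> X) (B : Y -> Y) (a b : R) :
  linear A -> linear B -> 0 <= a -> 0 <= b ->
  (forall x, rnorm (A x) <= a * rnorm x) ->
  (forall y, rnorm (B y) <= b * rnorm y) ->
  exists L : {linear T -> T}, (forall x y, L (tens x y) = tens (A x) (B y)) /\
    forall u, rnorm (L u) <= a * b * rnorm u.
Proof.
move=> Al Bl a0 b0 Aa Bb.
apply: (tens_lift hT (b := fun x y => tens (A x) (B y)) _ (mulr_ge0 a0 b0)).
  have [tl tr] := bilinear_map_bilinear tens.
  by split=> [y|x] c v w; [rewrite Al tl|rewrite Bl tr].
move=> x y; apply: le_trans (rnorm_tens hT _ _) _.
by rewrite mulrACA ler_pM ?rnorm_ge0.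
Qed.

(** On an elementary tensor, [PX F (x) PY G] differs from the identity by
[(x - PX F x) (x) y + PX F x (x) (y - PY G y)], which is eventually small; the
convergence extends to finite sums, and to [T] by density and uniform
boundedness. *)
Lemma tens_approx (I J : choiceType) (PX : {fset I} -> X -> X)
    (PY : {fset J} -> Y -> Y) (a b : R)
    (L : {fset I} -> {fset J} -> {linear T -> T}) :
  0 <= a -> 0 <= b ->
  (forall F x, rnorm (PX F x) <= a * rnorm x) ->
  (forall x e, 0 < e -> exists F0, forall F, (F0 `<=` F)%fset ->
     rnorm (x - PX F x) < e) ->
  (forall y e, 0 < e -> exists G0, forall G, (G0 `<=` G)%fset ->
     rnorm (y - PY G y) < e) ->
  (forall F G x y, L F G (tens x y) = tens (PX F x) (PY G y)) ->
  (forall F G u, rnorm (L F G u) <= a * b * rnorm u) ->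
  forall u e, 0 < e -> exists F0 G0, forall F G, (F0 `<=` F)%fset ->
    (G0 `<=` G)%fset -> rnorm (u - L F G u) < e.
Proof.
move=> a0 b0 PXa PXc PYc Lt Lab.
have elementary x y e : 0 < e -> exists F0 G0, forall F G, (F0 `<=` F)%fset ->
    (G0 `<=` G)%fset -> rnorm (tens x y - L F G (tens x y)) < e.
  move=> e0; set D := rnorm y + a * rnorm x + 1.
  have ax0 : 0 <= a * rnorm x by rewrite mulr_ge0 ?rnorm_ge0.
  have D0 : 0 < D by rewrite ltr_wpDl// addr_ge0 ?rnorm_ge0.
  have [F0 HF] := PXc x _ (divr_gt0 e0 D0).
  have [G0 HG] := PYc y _ (divr_gt0 e0 D0).
  exists F0, G0 => F G /HF xF /HG yG; rewrite Lt.
  have -> : tens x y - tens (PX F x) (PY G y) =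
      tens (x - PX F x) y + tens (PX F x) (y - PY G y).
    by rewrite linearBl linearBr subrKA.
  apply: le_lt_trans (rnormD _ _) _.
  have H1 : rnorm (tens (x - PX F x) y) <= e / D * rnorm y.
    apply: le_trans (rnorm_tens hT _ _) _.
    by rewrite ler_wpM2r ?rnorm_ge0// ltW.
  have H2 : rnorm (tens (PX F x) (y - PY G y)) <= a * rnorm x * (e / D).
    apply: le_trans (rnorm_tens hT _ _) _.
    by apply: ler_pM; rewrite ?rnorm_ge0// ltW.
  apply: le_lt_trans (lerD H1 H2) _.
  rewrite [X in _ + X]mulrC -mulrDr -mulrA gtr_pMr// mulrC ltr_pdivrMr// mul1r.
  by rewrite ltrDl.
have sums t e : 0 < e -> exists F0 G0, forall F G, (F0 `<=` F)%fset ->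
    (G0 `<=` G)%fset ->
    rnorm (\sum_(z <- t) tens z.1 z.2 - L F G (\sum_(z <- t) tens z.1 z.2)) < e.
  elim: t e => [|[x y] t IH] e e0.
    by exists fset0, fset0 => F G _ _; rewrite big_nil linear0 subr0 rnorm0.
  have e20 := divr_gt0 e0 (ltr0Sn R 1).
  have [F1 [G1 H1]] := elementary x y _ e20; have [F2 [G2 H2]] := IH _ e20.
  exists (F1 `|` F2)%fset, (G1 `|` G2)%fset => F G.
  rewrite !fsubUset => /andP[/H1 {}H1 /H2 {}H2] /andP[/H1 {}H1 /H2 {}H2].
  rewrite big_cons linearD opprD addrACA.
  by apply: le_lt_trans (rnormD _ _) _; rewrite (splitr e); exact: ltrD.
move=> u e e0; pose D := a * b + 2.
have ab0 : 0 <= a * b by rewrite mulr_ge0.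
have D0 : 0 < D by rewrite ltr_wpDl.
have eD0 := divr_gt0 e0 D0.
have [t ut] := tens_dense hT u eD0; have [F0 [G0 H]] := sums t _ eD0.
exists F0, G0 => F G FF GG; have {H} := H _ _ FF GG.
set v := \sum_(z <- t) _ in ut * => vL.
have -> : u - L F G u = (u - v) + (v - L F G v) - L F G (u - v).
  by rewrite linearB opprB subrKA addrA subrK.
apply: le_lt_trans (rnormD _ _) _; rewrite rnormN.
have H1 := rnormD (u - v) (v - L F G v).
have H2 := Lab F G (u - v).
have H3 : a * b * rnorm (u - v) <= a * b * (e / D) by rewrite ler_wpM2l// ltW.
have -> : e = e / D + e / D + a * b * (e / D).
  by rewrite /D; field; rewrite -/D gt_eqF.
by lra.
Qed.

End Operators.

(** * Absolutely convergent series of functionals *)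

(** After normalizing to [A = B = 1], all [b k] are at most one, so Young's
inequality with the exponents [p] and [p'], where [p'] is conjugate to [p], may
be weakened by replacing [p'] with [q <= p']. *)
Lemma hoelder_sum (R : realType) (p q : R) (n : nat) (a b : 'I_n -> R) (A B : R) :
  1 < p -> 1 < q -> 1 <= p^-1 + q^-1 -> 0 <= A -> 0 <= B ->
  (forall k, 0 <= a k) -> (forall k, 0 <= b k) ->
  (\sum_(k < n) a k `^ p) `^ p^-1 <= A ->
  (\sum_(k < n) b k `^ q) `^ q^-1 <= B ->
  \sum_(k < n) a k * b k <= A * B.
Proof.
move=> p1 q1 pq A0 B0 a0 b0 aA bB.
have normalize (r : R) (c : 'I_n -> R) (C : R) : 1 < r -> 0 <= C ->
    (forall k, 0 <= c k) -> (\sum_(k < n) c k `^ r) `^ r^-1 <= C ->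
    exists c' : 'I_n -> R, [/\ forall k, 0 <= c' k,
    forall k, c k = C * c' k & \sum_(k < n) c' k `^ r <= 1].
  move=> r1 C0 c0 cC; have r0 : 0 < r := lt_trans ltr01 r1.
  have {}cC : \sum_(k < n) c k `^ r <= C `^ r.
    have S0 : 0 <= \sum_(k < n) c k `^ r by apply: sumr_ge0 => k _; exact: powR_ge0.
    rewrite -[leLHS]powRr1// -(mulVf (lt0r_neq0 r0)) powRrM.
    by apply: ge0_ler_powR; rewrite ?nnegrE ?powR_ge0// ltW.
  exists (fun k => C^-1 * c k); split=> [k|k|].
  - by rewrite mulr_ge0 ?invr_ge0.
  - have [C00|Cn0] := eqVneq C 0; last by rewrite mulVKf.
    move: cC; rewrite C00 mul0r powR0 ?gt_eqF// => cC.
    apply/eqP; have := powR_eq0 (c k) r; rewrite (gt_eqF r0)/= andbT => <-.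
    rewrite eq_le powR_ge0 andbT; apply: le_trans cC.
    by rewrite (bigD1 k)//= lerDl sumr_ge0// => i _; exact: powR_ge0.
  under eq_bigr do rewrite powRM ?invr_ge0//.
  rewrite -mulr_sumr; apply: (@le_trans _ _ (C^-1 `^ r * C `^ r)).
    by rewrite ler_wpM2l// powR_ge0.
  rewrite -powRM ?invr_ge0//.
  have [->|Cn0] := eqVneq C 0; first by rewrite mulr0 powR0 ?gt_eqF.
  by rewrite mulVf// powR1.
have [a' [a'0 aE a'S]] := normalize _ _ _ p1 A0 a0 aA.
have [b' [b'0 bE b'S]] := normalize _ _ _ q1 B0 b0 bB.
under eq_bigr do rewrite aE bE mulrACA.
rewrite -mulr_sumr -[leRHS]mulr1 ler_wpM2l ?mulr_ge0//.
have p0 : 0 < p := lt_trans ltr01 p1.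
have q0 : 0 < q := lt_trans ltr01 q1.
have pV : p^-1 < 1 by rewrite invf_lt1.
pose p' := (1 - p^-1)^-1.
have p'0 : 0 < p' by rewrite invr_gt0 subr_gt0.
have pp' : p^-1 + p'^-1 = 1 by rewrite invrK addrC subrK.
have qp' : q <= p'.
  by rewrite -[q]invrK /p' lef_pV2 ?posrE ?invr_gt0 ?subr_gt0// lerBlDl.
have b'p k : b' k `^ p' <= b' k `^ q.
  have [->|bk0] := eqVneq (b' k) 0; first by rewrite !powR0 ?gt_eqF.
  apply: ger_powR => //; rewrite lt0r bk0 b'0/=.
  rewrite leNgt; apply/negP => bk1.
  have : 1 < b' k `^ q by exact: lt_le_trans bk1 (le1r_powR (ltW bk1) (ltW q1)).
  apply/negP; rewrite -leNgt; apply: le_trans b'S.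
  by rewrite (bigD1 k)//= lerDl sumr_ge0// => i _; exact: powR_ge0.
apply: (@le_trans _ _ (\sum_(k < n) (a' k `^ p / p + b' k `^ q / p'))).
  apply: ler_sum => k _; apply: le_trans (conjugate_powR _ _ p0 p'0 pp') _ => //.
  by rewrite lerD2l ler_wpM2r// invr_ge0 ltW.
rewrite big_split/= -!mulr_suml -pp'.
by apply: lerD; rewrite -[leRHS]mul1r ler_wpM2r// invr_ge0 ltW.
Qed.

Section Functionals.
Variables (R : realType) (s : scalar_kind).
Notation K := (scalars R s).

(** Only the real parts are summed, in the complete field [R]; the
scalar-linear sum is recovered from its real part. *)
Lemma functional_series (V : normedModType K) (h : nat -> {linear V -> K^o}) C :
  (forall N v, \sum_(k < N) `|scalar_re (h k v : K)| <= C * rnorm v) ->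
  exists f : {linear V -> K^o}, bounded_map f /\ forall v,
    (fun N => \sum_(k < N) scalar_re (h k v : K)) @ \oo --> scalar_re (f v : K).
Proof.
move=> hC; pose S v := (fun N => \sum_(k < N) scalar_re (h k v : K)).
have Scvg v : cvg (S v @ \oo).
  have -> : S v = series (fun k => scalar_re (h k v : K)).
    by apply/funext => N; rewrite /S /series /= big_mkord.
  apply: normed_cvg; apply: nondecreasing_is_cvgn.
    by apply: nondecreasing_series => k _ _; exact: normr_ge0.
  exists (C * rnorm v) => _ [N _ <-].
  by rewrite /= seriesEord; exact: hC.
pose g v := lim (S v @ \oo).
have gS v : S v @ \oo --> g v by exact: Scvg.
have hD k x y : scalar_re (h k (x + y) : K) =
    scalar_re (h k x : K) + scalar_re (h k y : K).
  by rewrite (linearD (h k)) scalar_reD.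
have gD x y : g (x + y) = g x + g y.
  apply: (cvg_unique _ (gS (x + y))) => //.
  rewrite (_ : S (x + y) = S x + S y); first exact: cvgD.
  apply/funext => N; rewrite /S -[RHS]/(S x N + S y N) -big_split.
  by apply: eq_bigr => k _; exact: hD.
have gZ a x : g (of_re s a *: x) = a * g x.
  apply: (cvg_unique _ (gS (of_re s a *: x))) => //.
  rewrite (_ : S _ = (fun N => a * S x N)).
    by apply: cvgM => //; exact: cvg_cst.
  apply/funext => N; rewrite /S mulr_sumr.
  by apply: eq_bigr => k _; rewrite (linearZ_LR (h k)) scalar_reZ.
have gC v : g v <= C * rnorm v.
  apply: limr_le; first exact: Scvg.
  apply: nearW => N; apply: le_trans (hC N v).
  by apply: ler_sum => k _; exact: ler_norm.
have [f [fg fC]] := real_functional_lift gD gZ gC.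
by exists f; split=> [|v]; [exists C|rewrite fg; exact: gS].
Qed.

Variables (X Y : normedModType K) (T : completeNormedModType K).
Variables (tens : {bilinear X -> Y -> T}) (hT : projective_tensor_product tens).

(** The left-hand side is the real part of the value at [v] of a signed sum of
the [h k], to which [tens_bound] applies.  The signs depend on [v], but the bound
on elementary tensors is the same for all signs. *)
Lemma sum_functionals_bound (n : nat) (h : 'I_n -> {linear T -> K^o}) (D C : R) :
  (forall k v, scalar_re `|h k v : K| <= D * rnorm v) -> 0 <= C ->
  (forall x y, \sum_(k < n) scalar_re `|h k (tens x y) : K|
     <= C * (rnorm x * rnorm y)) ->
  forall v, \sum_(k < n) `|scalar_re (h k v : K)| <= C * rnorm v.
Proof.
move=> hD C0 hC v.
pose t k := of_re s (Num.sg (scalar_re (h k v : K))).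
have t1 k : scalar_re `|t k| <= 1.
  rewrite /t of_re_norm of_reK normr_sg.
  by case: (_ != 0).
have th k x : scalar_re `|(t k *: h k x : K^o) : K| <= scalar_re `|h k x : K|.
  have /= := rnormZ (t k) (h k x); rewrite {1}/rnorm => ->.
  by rewrite -[leRHS]mul1r ler_wpM2r ?rnorm_ge0.
have [L LE] : exists L : {linear T -> K^o},
    forall x, L x = \sum_(k < n) t k *: h k x.
  apply: (@linear_pack _ _ _ _ (fun x => \sum_(k < n) t k *: h k x : K^o)).
  move=> a x y; rewrite scaler_sumr -big_split; apply: eq_bigr => k _.
  by rewrite (linearP (h k)) scalerDr !scalerA [t k * a]mulrC.
have Lb : bounded_map L.
  exists (\sum_(k < n) D) => x; rewrite LE mulr_suml.
  apply: le_trans (rnorm_sum _ _) _; apply: ler_sum => k _.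
  exact: le_trans (th _ _) (hD _ _).
have LC : rnorm (L v) <= C * rnorm v.
  apply: (tens_bound hT Lb C0) => x y; rewrite LE.
  apply: le_trans (rnorm_sum _ _) _; apply: le_trans (hC x y).
  by apply: ler_sum => k _; exact: th.
apply: le_trans LC; apply: le_trans _ (ler_scalar_re _).
apply: le_trans _ (ler_norm _); rewrite LE scalar_re_sum.
apply: ler_sum => k _.
by rewrite /GRing.scale /= scalar_reZ -normrEsg.
Qed.

End Functionals.

(** * Gliding hump *)

(** The recursion increases both finite sets, and the blocks are the differences
of successive sets; asking for an index beyond the previous one gives
[k <= n k]. *)
Lemma gliding_hump (I J : choiceType) (P : nat -> {fset I} -> {fset J} -> Prop) :
  (forall N F' G', exists n F G, [/\ (N <= n)%N, (F' `<=` F)%fset,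
     (G' `<=` G)%fset & P n (F `\` F')%fset (G `\` G')%fset]) ->
  exists (n : nat -> nat) F G, [/\ forall k, (k <= n k)%N,
    forall k l, k != l -> [disjoint F k & F l]%fset,
    forall k l, k != l -> [disjoint G k & G l]%fset &
    forall k, P (n k) (F k) (G k)].
Proof.
move=> step.
have /choice[nxt Hnxt] : forall st : nat * {fset I} * {fset J}, exists st',
    [/\ (st.1.1 < st'.1.1)%N, (st.1.2 `<=` st'.1.2)%fset,
     (st.2 `<=` st'.2)%fset &
     P st'.1.1 (st'.1.2 `\` st.1.2)%fset (st'.2 `\` st.2)%fset].
  move=> [[N F'] G']; have [n [F [G H]]] := step N.+1 F' G'.
  by exists (n, F, G).
pose st k := iter k nxt (0%N, fset0, fset0).
have stS k : st k.+1 = nxt (st k) by [].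
have grow (U : choiceType) (S : nat -> {fset U}) :
    (forall k, (S k `<=` S k.+1)%fset) ->
    forall k l, k != l -> [disjoint S k.+1 `\` S k & S l.+1 `\` S l]%fset.
  move=> SS.
  have Smono k l : (k <= l)%N -> (S k `<=` S l)%fset.
    move=> kl; rewrite -(subnKC kl); elim: (l - k)%N => [|m IH].
      by rewrite addn0.
    by rewrite addnS; exact: fsubset_trans IH (SS _).
  have lt k l : (k < l)%N -> [disjoint S k.+1 `\` S k & S l.+1 `\` S l]%fset.
    move=> kl; apply/fdisjointP => i; rewrite !inE => /andP[_ iS].
    by rewrite (fsubsetP (Smono _ _ kl) _ iS).
  move=> k l; rewrite neq_ltn => /orP[/lt//|/lt].
  by rewrite fdisjoint_sym.
exists (fun k => (st k.+1).1.1), (fun k => (st k.+1).1.2 `\` (st k).1.2)%fset,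
  (fun k => (st k.+1).2 `\` (st k).2)%fset; split.
- elim=> [//|k IH]; rewrite stS; have [H _ _ _] := Hnxt (st k.+1).
  exact: leq_ltn_trans IH H.
- by apply: grow => k; rewrite stS; have [] := Hnxt (st k).
- by apply: grow => k; rewrite stS; have [] := Hnxt (st k).
- by move=> k; rewrite stS; have [] := Hnxt (st k).
Qed.

Section WeaklyNullSequences.
Variables (R : realType) (s : scalar_kind) (p q : R).
Notation K := (scalars R s).
Hypotheses (hp : 1 < p) (hq : 1 < q) (hpq : 1 <= p^-1 + q^-1).
Variables (X Y : completeNormedModType K) (I J : choiceType).
Variables (Xs : I -> set X) (Ys : J -> set Y).
Hypotheses (hX : unconditional_decomposition Xs)
  (hXfin : forall i, finite_dimensional (Xs i))
  (hY : unconditional_decomposition Ys)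
  (hYfin : forall j, finite_dimensional (Ys j))
  (hXp : disjoint_lower_estimate Xs p) (hYq : disjoint_lower_estimate Ys q)
  (schurX : schur X) (schurY : schur Y).
Variables (T : completeNormedModType K) (tens : {bilinear X -> Y -> T}).
Hypothesis hT : projective_tensor_product tens.

Let PX := proj_on Xs.
Let PY := proj_on Ys.

(** On an elementary tensor the sum is at most
[sum_k |PX (F k) x| |PY (G k) y|], to which Hoelder's inequality and the two
lower estimates apply. *)
Lemma block_functionals_bound : exists2 C, 0 <= C &
  forall (n : nat) (F : nat -> {fset I}) (G : nat -> {fset J})
    (h phi : nat -> {linear T -> K^o}) (D : R),
  (forall k l, k != l -> [disjoint F k & F l]%fset) ->
  (forall k l, k != l -> [disjoint G k & G l]%fset) ->
  (forall k v, scalar_re `|phi k v : K| <= rnorm v) ->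
  (forall k v, scalar_re `|h k v : K| <= D * rnorm v) ->
  (forall k x y, h k (tens x y) = phi k (tens (PX (F k) x) (PY (G k) y))) ->
  forall v, \sum_(k < n) `|scalar_re (h k v : K)| <= C * rnorm v.
Proof.
have [c c0 Hc] := hXp; have [d d0 Hd] := hYq.
have cd0 : 0 <= c * d by rewrite mulr_ge0// ltW.
exists (c * d) => // n F G h phi D FF GG phi1 hD hphi.
apply: (sum_functionals_bound hT (h := fun k : 'I_n => h k) _ cd0) => // x y.
apply: (@le_trans _ _ (\sum_(k < n) rnorm (PX (F k) x) * rnorm (PY (G k) y))).
  apply: ler_sum => k _; rewrite hphi.
  exact: le_trans (phi1 _ _) (rnorm_tens hT _ _).
rewrite mulrACA; apply: (hoelder_sum hp hq hpq) => //.
- by rewrite mulr_ge0 ?rnorm_ge0// ltW.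
- by rewrite mulr_ge0 ?rnorm_ge0// ltW.
- by move=> k; exact: rnorm_ge0.
- by move=> k; exact: rnorm_ge0.
- by apply: (Hc n (fun k => F k)) => k l kl; apply: FF.
- by apply: (Hd n (fun k => G k)) => k l kl; apply: GG.
Qed.

(** [LX] and [LY] are kept besides [L] because they are the operators that send
weakly null sequences to norm null ones. *)
Lemma block_operators : exists (a b : R)
    (L : {fset I} -> {fset J} -> {linear T -> T})
    (LX : {fset I} -> {linear T -> T}) (LY : {fset J} -> {linear T -> T}),
  [/\ 0 <= a /\ 0 <= b,
    forall F G x y, L F G (tens x y) = tens (PX F x) (PY G y),
    forall F x y, LX F (tens x y) = tens (PX F x) y,
    forall G x y, LY G (tens x y) = tens x (PY G y) &
    [/\ forall F G u, rnorm (L F G u) <= a * b * rnorm u,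
      forall F u, rnorm (LX F u) <= a * rnorm u,
      forall G u, rnorm (LY G u) <= b * rnorm u &
      forall u e, 0 < e -> exists F0 G0, forall F G, (F0 `<=` F)%fset ->
        (G0 `<=` G)%fset -> rnorm (u - L F G u) < e]].
Proof.
have p0 := lt_trans ltr01 hp; have q0 := lt_trans ltr01 hq.
have [a a0 Pa] := proj_on_bounded p0 hXp; have [b b0 Pb] := proj_on_bounded q0 hYq.
have Xl F := proj_on_linear hX F; have Yl G := proj_on_linear hY G.
have /choice[L HL] : forall FG : {fset I} * {fset J}, exists L : {linear T -> T},
    (forall x y, L (tens x y) = tens (PX FG.1 x) (PY FG.2 y)) /\
    forall u, rnorm (L u) <= a * b * rnorm u.
  by move=> FG; apply: tens_operator.
have /choice[LX HLX] : forall F : {fset I}, exists L : {linear T -> T},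
    (forall x y, L (tens x y) = tens (PX F x) y) /\
    forall u, rnorm (L u) <= a * 1 * rnorm u.
  by move=> F; apply: (tens_operator hT (B := id)) => // y; rewrite mul1r.
have /choice[LY HLY] : forall G : {fset J}, exists L : {linear T -> T},
    (forall x y, L (tens x y) = tens x (PY G y)) /\
    forall u, rnorm (L u) <= 1 * b * rnorm u.
  by move=> G; apply: (tens_operator hT (A := id)) => // y; rewrite mul1r.
exists a, b, (fun F G => L (F, G)), LX, LY; split=> //.
- by move=> F G x y; rewrite (HL (F, G)).1.
- by move=> F x y; rewrite (HLX F).1.
- by move=> G x y; rewrite (HLY G).1.
split.
- by move=> F G u; exact: (HL (F, G)).2.
- by move=> F u; have := (HLX F).2 u; rewrite mulr1.
- by move=> G u; have := (HLY G).2 u; rewrite mul1r.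
apply: (tens_approx hT a0 b0 Pa).
- exact: (proj_on_cvg hX).
- exact: (proj_on_cvg hY).
- by move=> F G x y; rewrite (HL (F, G)).1.
- by move=> F G u; exact: (HL (F, G)).2.
Qed.

(** Otherwise the functional built on the blocks chosen along [u] has real part
at least [delta / 2] at infinitely many [u n]. *)
Lemma weakly_null_cvg0 (u : nat -> T) : weakly_cvg u 0 -> u @ \oo --> (0 : T).
Proof.
move=> u0; apply: contrapT => ucvg.
have [delta delta0 ularge] : exists2 delta : R, 0 < delta &
    forall N, exists2 n, (N <= n)%N & delta <= rnorm (u n).
  apply: contrapT => H; apply: ucvg; apply/cvg_seq_rnormP => e e0.
  apply: contrapT => He; apply: H; exists e => // N.
  apply: contrapT => HN; apply: He; exists N => n Nn.
  rewrite sub0r rnormN ltNge; apply/negP => en; apply: HN; by exists n.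
have [a [b [L [LX [LY [[a0 b0] Lt LXt LYt [Lab LXa LYb Lcvg]]]]]]] :=
  block_operators.
have [C C0 HC] := block_functionals_bound.
have Lb F G : bounded_map (L F G) by exists (a * b); exact: Lab.
have LXb F : bounded_map (LX F) by exists a; exact: LXa.
have LYb' G : bounded_map (LY G) by exists b; exact: LYb.
have p0 := lt_trans ltr01 hp; have q0 := lt_trans ltr01 hq.
have LXu F : (LX F \o u) @ \oo --> (0 : T).
  apply: (finite_rank_weakly_null (universal_tensor_tens hT) schurY
    _ (LXb F) (LXt F) u0).
  by apply: finite_rank_proj_on => //; exact: proj_on_bounded hXp.
have LYu G : (LY G \o u) @ \oo --> (0 : T).
  apply: (finite_rank_weakly_null (universal_tensor_sym (universal_tensor_tens hT))
    schurX (A := PY G) _ (LYb' G) _ u0) => //.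
  by apply: finite_rank_proj_on => //; exact: proj_on_bounded hYq.
(* three of the four terms pass through [LX F'] or [LY G'], and become small
   along [u] *)
have Ldiff F F' G G' v : (F' `<=` F)%fset -> (G' `<=` G)%fset ->
    L (F `\` F')%fset (G `\` G')%fset v =
    (L F G v - LY G (LX F' v)) - (LX F (LY G' v) - LY G' (LX F' v)).
  move=> FF GG.
  apply: (@tens_ext _ _ _ _ _ _ hT _ _
    ((L F G \- (LY G \o LX F')%FUN) \-
      ((LX F \o LY G')%FUN \- (LY G' \o LX F')%FUN))%R).
  - by [].
  - apply: bounded_mapB (bounded_mapB (Lb F G) _) (bounded_mapB _ _).
    + exact: bounded_map_comp (LYb' G) (LXb F').
    + exact: bounded_map_comp (LXb F) (LYb' G').
    + exact: bounded_map_comp (LYb' G') (LXb F').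
  move=> x y; rewrite /= !(Lt, LXt, LYt) /PX /PY !proj_onD//.
  by rewrite linearBr !linearBl.
(* an error [eta] changes the [k]-th term at [u (n k)] by at most [eta] and the
   sum of the others by at most [C * eta]; both together amount to [delta / 2] *)
pose eta := delta / (2 * (1 + C)).
have C10 : 0 < 1 + C by rewrite ltr_pwDl.
have eta0 : 0 < eta by rewrite divr_gt0// mulr_gt0.
pose block n F G := delta <= rnorm (u n) /\ rnorm (u n - L F G (u n)) <= eta.
have step N F' G' : exists n F G, [/\ (N <= n)%N, (F' `<=` F)%fset,
    (G' `<=` G)%fset & block n (F `\` F')%fset (G `\` G')%fset].
  (* errors at most [e] in the approximation of [u n] by [L F G (u n)] and in
     [LX F' (u n)], [LY G' (u n)] add up to at most [(1 + 2 * b + a) * e] *)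
  pose D := 2 + 2 * b + a.
  have D0 : 0 < D by rewrite /D; lra.
  pose e := eta / D.
  have e0 : 0 < e by rewrite divr_gt0.
  have [N1 H1] := (cvg_seq_rnormP _ _).1 (LXu F') _ e0.
  have [N2 H2] := (cvg_seq_rnormP _ _).1 (LYu G') _ e0.
  have [n] := ularge (maxn N (maxn N1 N2)).
  rewrite !geq_max => /and3P[Nn /H1 {}H1 /H2 {}H2] dn.
  have [F0 [G0 H]] := Lcvg (u n) _ e0.
  exists n, (F' `|` F0)%fset, (G' `|` G0)%fset.
  split; [by []|exact: fsubsetUl|exact: fsubsetUl|split=> //].
  rewrite Ldiff ?fsubsetUl//; set F := (F' `|` F0)%fset; set G := (G' `|` G0)%fset.
  have {}H := H F G (fsubsetUr _ _) (fsubsetUr _ _).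
  move: H1 H2; rewrite !sub0r !rnormN /= => H1 H2.
  have E1 : rnorm (LY G (LX F' (u n))) <= b * e.
    by apply: le_trans (LYb _ _) _; rewrite ler_wpM2l// ltW.
  have E2 : rnorm (LX F (LY G' (u n))) <= a * e.
    by apply: le_trans (LXa _ _) _; rewrite ler_wpM2l// ltW.
  have E3 : rnorm (LY G' (LX F' (u n))) <= b * e.
    by apply: le_trans (LYb _ _) _; rewrite ler_wpM2l// ltW.
  set w0 := L F G (u n) in H *; set w1 := LY G _ in E1 *.
  set w2 := LX F _ in E2 *; set w3 := LY G' _ in E3 *.
  have -> : u n - (w0 - w1 - (w2 - w3)) = (u n - w0) + w1 + (w2 - w3).
    by rewrite !opprB [w2 - w3 + _]addrC addrA [w1 - w0]addrC addrA.
  have T1 := rnormD (u n - w0 + w1) (w2 - w3); have T2 := rnormD (u n - w0) w1.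
  have T3 := rnormD w2 (- w3); rewrite rnormN in T3.
  have : (2 + 2 * b + a) * e = eta by rewrite -/D /e mulrC divfK// gt_eqF.
  by rewrite !mulrDl => <-; lra.
have [n [F [G [nk FF GG ublock]]]] := gliding_hump step.
have /choice[phi Hphi] k := norming_functional (u (n k)).
pose B k : {linear T -> T} := L (F k) (G k).
have Borth j k v : j != k -> B j (B k v) = 0.
  move=> jk; apply: rnorm_eq0; apply/eqP; rewrite eq_le rnorm_ge0 andbT.
  rewrite -[leRHS](mul0r (rnorm v)).
  apply: (@tens_bound _ _ _ _ _ _ hT _ (B j \o B k)%FUN) => //.
    exact: bounded_map_comp (Lb _ _) (Lb _ _).
  move=> x y; rewrite /= !Lt /PX (proj_on_disjoint hX)// ?linear0l ?rnorm0 ?mul0r//.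
  exact: FF.
pose h k : {linear T -> K^o} := (phi k \o B k)%FUN.
have hsum N := HC N F G h phi (a * b) FF GG (fun k => (Hphi k).2) _ _.
have {}hsum N v : \sum_(k < N) `|scalar_re (h k v : K)| <= C * rnorm v.
  apply: hsum => [k w|k x y]; last by rewrite /h /= Lt.
  exact: le_trans ((Hphi k).2 _) (Lab _ _ _).
have [f [fb fh]] := functional_series hsum.
have flarge k : delta / 2 <= scalar_re (f (u (n k)) : K).
  have [dk ek] := ublock k.
  set z := u (n k) in dk ek *; set w := B k z in ek.
  apply: (cvgr_to_ge (fh z)).
  exists k.+1 => // N /= kN.
  pose k' := Ordinal kN.
  have hD (j : nat) x y : scalar_re (h j (x + y) : K) =
      scalar_re (h j x : K) + scalar_re (h j y : K).
    by rewrite (linearD (h j)) scalar_reD.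
  have zw : z = (z - w) + w by rewrite subrK.
  rewrite (bigD1 k')//=.
  (* the other terms do not see the block [w] *)
  have -> : \sum_(j < N | j != k') scalar_re (h j z : K) =
      \sum_(j < N | j != k') scalar_re (h j (z - w) : K).
    apply: eq_bigr => j jk; rewrite {1}zw hD -[RHS]addr0; congr (_ + _).
    by rewrite /h /= Borth// linear0 scalar_re0.
  have H1 : - (C * eta) <= \sum_(j < N | j != k') scalar_re (h j (z - w) : K).
    rewrite lerNl -sumrN.
    apply: (@le_trans _ _ (\sum_(j < N | j != k') `|scalar_re (h j (z - w) : K)|)).
      by apply: ler_sum => j _; rewrite -normrN ler_norm.
    apply: (@le_trans _ _ (\sum_(j < N) `|scalar_re (h j (z - w) : K)|)).
      by rewrite [leRHS](bigD1 k')//= lerDr.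
    by apply: le_trans (hsum _ _) _; rewrite ler_wpM2l.
  have H2 : delta - eta <= scalar_re (h k z : K).
    have [phi1 phi2] := Hphi k.
    have : scalar_re (phi k z : K) =
        scalar_re (phi k (z - w) : K) + scalar_re (h k z : K).
      by rewrite {1}zw (linearD (phi k)) scalar_reD.
    rewrite phi1 => E.
    have := le_trans (ler_norm _) (ler_scalar_re (phi k (z - w) : K)).
    have := phi2 (z - w); lra.
  have H3 : eta + C * eta = delta / 2.
    by rewrite -[X in X + _]mul1r -mulrDl /eta; field; rewrite gt_eqF.
  by lra.
have [D fD] := fb.
have fc : continuous f := rnorm_bounded_continuous fD.
have f0 := u0 f fc; rewrite linear0 in f0.
have [N HN] := (@cvg_seq_rnormP R s K^o _ _).1 f0 _ (divr_gt0 delta0 (ltr0Sn R 1)).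
have := HN (n N) (nk N); rewrite sub0r rnormN => H.
have := le_trans (ler_norm _) (ler_scalar_re (f (u (n N)) : K)).
have := flarge N; rewrite /rnorm /= in H *; lra.
Qed.

End WeaklyNullSequences.

Theorem theorem3p16 (R : realType) (s : scalar_kind) (p q : R)
    (hp : 1 < p) (hq : 1 < q) (hpq : 1 <= p^-1 + q^-1)
    (X Y : completeNormedModType (scalars R s))
    (I J : choiceType) (Xs : I -> set X) (Ys : J -> set Y)
    (hX : unconditional_decomposition Xs)
    (hXfin : forall i, finite_dimensional (Xs i))
    (hY : unconditional_decomposition Ys)
    (hYfin : forall j, finite_dimensional (Ys j))
    (hXp : disjoint_lower_estimate Xs p)
    (hYq : disjoint_lower_estimate Ys q)
    (schurX : schur X) (schurY : schur Y)
    (T : completeNormedModType (scalars R s)) (tens : {bilinear X -> Y -> T})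
    (hT : projective_tensor_product tens) :
  schur T.
Proof.
move=> u x ux.
have u0 : weakly_cvg (fun n => u n - x) 0.
  move=> f fc; have fx := ux f fc; rewrite linear0 -(subrr (f x)).
  have -> : f \o (fun n => u n - x) = (f \o u) - (fun=> f x).
    by apply/funext => n; exact: linearB.
  by apply: cvgB => //; exact: cvg_cst.
have H := weakly_null_cvg0 hp hq hpq hX hXfin hY hYfin hXp hYq schurX schurY hT u0.
apply/cvg_ex; exists x; apply/cvg_seq_rnormP => e e0.
have [N HN] := (cvg_seq_rnormP _ _).1 H _ e0.
by exists N => n /HN; rewrite sub0r opprB.
Qed.
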